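(* Let $\kappa\ge1$, $b\ge0$, $n\ge1$ be integers. Let $ss_{b,\kappa}(n)$ be the number of multiplex siteswaps of length $n$ using exactly $b$ balls in which at every beat at most $\kappa$ balls are thrown, and let $jp_{b,\kappa}(n)$ be the number of multiplex juggling patterns with exactly $b$ balls and minimal period $n$ in which at every beat at most $\kappa$ balls are thrown. Then \[ ss_{b,\kappa}(n)=\operatorname{trace}(A_{b,\kappa}^n)-\sum_{i=\max\{0,b-\kappa\}}^{b-1}\operatorname{trace}(A_{i,\kappa}^n), \] and \[ jp_{b,\kappa}(n)=\frac1n\sum_{d\mid n}\mu\!\left(\tfrac{n}{d}\right)\left(\operatorname{trace}(A_{b,\kappa}^d)-\sum_{i=\max\{0,b-\kappa\}}^{b-1}\operatorname{trace}(A_{i,\kappa}^d)\right), \] where $\mu$ is the M\''obius function.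
   Context: For an integer $b\ge 0$, an ordered partition of $b$ is a finite sequence $(q_1,\ldots,q_k)$ of positive integers summing to $b$ (for $b=0$ the only one is the empty sequence). An ordered partition $(q_1,\ldots,q_k)$ with $k\ge1$ is nontrivially embedded into an ordered partition $(r_1,\ldots,r_\ell)$ by a choice of indices $1\le i_2<\cdots<i_k\le \ell$ with $q_j\le r_{i_j}$ for $2\le j\le k$; different index tuples count as different embeddings. A card for $b$ balls is either (i) a trivial card, given by an ordered partition $q$ of $b$, with left and right partitions both $q$; or (ii) a throw card, given by ordered partitions $q$ ($k\ge1$ parts) and $r$ of $b$ together with a nontrivial embedding of $q$ into $r$, with left partition $q$ and right partition $r$. Different index tuples give different cards, and a throw card is distinct from the trivial card even when $q=r$. $A_b$ is the square matrix with rows and columns indexed by the ordered partitions of $b$ whose $(u,v)$ entry is the number of cards for $b$ balls with left partition $u$ and right partition $v$; $A_{b,\kappa}$ is the principal submatrix of $A_b$ on the rows and columns indexed by ordered partitions of $b$ all of whose parts are at most $\kappa$. A multiplex siteswap of length $n$ is a sequence $(M_0,\ldots,M_{n-1})$, indexed by $t\in\mathbb{Z}/n\mathbb{Z}$, of finite multisets of positive integers ($M_t$ is the multiset of throw heights at beat $t$, so $|M_t|$ balls are thrown at beat $t$) such that for every $t$, $|M_t|$ equals the number of pairs $(s,h)$ with $h$ an element of $M_s$ (with multiplicity) and $s+h\equiv t\pmod n$; its number of balls is $\frac1n\sum_t\sum_{h\in M_t}h$. Rotations are counted as different siteswaps. Its minimal period is the least $d\ge1$ with $M_{t+d}=M_t$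 for all $t$. A multiplex juggling pattern with $b$ balls and minimal period $n$ is an orbit, under cyclic rotation, of multiplex siteswaps of length $n$ with $b$ balls and minimal period $n$. *)

(* Defs.v *)
From mathcomp Require Import all_boot all_order all_algebra.
Set Implicit Arguments. Unset Strict Implicit. Unset Printing Implicit Defensive.
Import GRing.Theory Num.Theory.

Definition is_ordpart (b : nat) (s : seq nat) : bool :=
  all (fun q => 0 < q) s && (sumn s == b).

(* Enumeration of all ordered partitions of b (first part q, then an ordered
   partition of b - q); fuel = b suffices. *)
Fixpoint comps_aux (fuel b : nat) : seq (seq nat) :=
  if b == 0 then [:: [::]] else
  match fuel with
  | 0 => [::]
  | fuel'.+1 =>
      flatten [seq [seq q :: s | s <- comps_aux fuel' (b - q)] | q <- iota 1 b]
  end.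

Definition comps (b : nat) : seq (seq nat) := comps_aux b b.

Definition comps_k (b kappa : nat) : seq (seq nat) :=
  [seq s <- comps b | all (fun q => q <= kappa) s].

(* number of nontrivial embeddings of q = (q_1,...,q_k), k >= 1, into r:
   index tuples 1 <= i_2 < ... < i_k <= size r with q_j <= r_{i_j},
   encoded as bit masks selecting the indices i_2 < ... < i_k. *)
Definition n_embed (q r : seq nat) : nat :=
  #|[set m : (size r).-tuple bool |
       (count id m == (size q).-1) && all2 leq (behead q) (mask m r)]|.

(* number of cards with left partition u and right partition v *)
Definition n_cards (u v : seq nat) : nat :=
  (u == v) + (if u is _ :: _ then n_embed u v else 0).

Definition Amx (b kappa : nat) : 'M[int]_(size (comps_k b kappa)) :=
  \matrix_(i, j) (n_cards (nth [::] (comps_k b kappa) i)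
                          (nth [::] (comps_k b kappa) j))%:Z%R.

Definition trA (b kappa n : nat) : int := (\tr ((Amx b kappa) ^+ n))%R.

(* ---------- Multiplex siteswaps ----------
   A multiset of positive integers is represented canonically by a
   nondecreasing sorted list; a siteswap of length n by a list of n such. *)

Definition is_multiset (m : seq nat) : bool :=
  sorted leq m && all (fun h => 0 < h) m.

Definition landings (n : nat) (M : seq (seq nat)) (t : nat) : nat :=
  \sum_(s < n) count (fun h => (s + h) %% n == t) (nth [::] M s).

Definition is_siteswap (n : nat) (M : seq (seq nat)) : Prop :=
  [/\ size M = n, all is_multiset M &
      forall t, t < n -> size (nth [::] M t) = landings n M t].

Definition has_balls (n b : nat) (M : seq (seq nat)) : Prop :=
  \sum_(t < n) sumn (nth [::] M t) = b * n.

Definition max_mult (kappa : nat) (M : seq (seq nat)) : Prop :=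
  all (fun m => size m <= kappa) M.

Definition ss_valid (n b kappa : nat) (M : seq (seq nat)) : Prop :=
  [/\ is_siteswap n M, has_balls n b M & max_mult kappa M].

Definition min_period (n : nat) (M : seq (seq nat)) : Prop :=
  forall d, 0 < d < n -> rot d M <> M.

Definition rot_equiv (M1 M2 : seq (seq nat)) : Prop :=
  exists k, rot k M1 = M2.

Definition mobius (m : nat) : int :=
  if all (fun p => logn p m == 1) (primes m) then ((-1) ^+ size (primes m))%R else 0%R.

(* Main.v *)
Require Import Defs.
From mathcomp Require Import all_boot all_order all_algebra zify.
Set Implicit Arguments. Unset Strict Implicit. Unset Printing Implicit Defensive.
Import GRing.Theory Num.Theory.

(** A closed walk of [n] cards on [b] balls is turned back into juggling by
    reading off when each part of a state reaches the front and is thrown. This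
    fails only if some parts never land. Such parts form a common suffix of all
    the states and never receive a ball, so stripping the last of them, of size
    [j <= kappa], gives an arbitrary closed walk on [b - j] balls; hence
    [tr A_b^n - sum_j tr A_(b-j)^n] counts the walks in which everything lands.

    These correspond to siteswaps through the table [sg t s], the number of
    balls in the air at time [t] that land at time [t + s]: it satisfies
    [sg t (s+1) <= sg (t+1) s], and the excess is the number of balls thrown at
    time [t] to height [s + 1]. Deleting the zeros of [sg t] gives the state of
    the walk at time [t].

    A siteswap is a repetition of a unique primitive one, and a primitive
    siteswap of length [n] has [n] distinct rotations, so the second formula
    follows from the first by Moebius inversion. *)

(** * Cardinalities of predicates *)

Definition has_card (T : eqType) (P : T -> Prop) (z : int) : Prop :=
  exists L : seq T, [/\ uniq L, forall x, x \in L <-> P x & (size L)%:Z%R = z].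

Lemma has_card_image (T U : eqType) (P : T -> Prop) (Q : U -> Prop)
    (f : T -> U) z :
    has_card P z ->
    (forall x y, P x -> P y -> f x = f y -> x = y) ->
    (forall y, Q y <-> exists2 x, P x & y = f x) ->
  has_card Q z.
Proof.
move=> [L [uL memL szL]] inj_f imf; exists (map f L); split.
- by rewrite map_inj_in_uniq // => x y /memL Px /memL Py; apply: inj_f.
- move=> y; split.
    by move=> /mapP[x /memL Px ->]; apply/imf; exists x.
  by move=> /imf[x /memL Lx ->]; apply: map_f.
- by rewrite size_map.
Qed.

Lemma has_card_bij (T U : eqType) (P : T -> Prop) (Q : U -> Prop)
    (f : T -> U) (g : U -> T) z :
    has_card P z ->
    (forall x, P x -> Q (f x)) -> (forall y, Q y -> P (g y)) ->
    (forall x, P x -> g (f x) = x) -> (forall y, Q y -> f (g y) = y) ->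
  has_card Q z.
Proof.
move=> cP PQ QP gf fg; apply: (has_card_image (f := f) cP).
  by move=> x y Px Py /(congr1 g); rewrite !gf.
move=> y; split=> [Qy|[x Px ->]]; last exact: PQ.
by exists (g y); [apply: QP | rewrite fg].
Qed.

Lemma has_card_iff (T : eqType) (P Q : T -> Prop) z :
  has_card P z -> (forall x, P x <-> Q x) -> has_card Q z.
Proof.
by move=> [L [uL mL sL]] PQ; exists L; split=> // x; rewrite mL.
Qed.

Lemma has_card_inj (T : eqType) (P : T -> Prop) z1 z2 :
  has_card P z1 -> has_card P z2 -> z1 = z2.
Proof.
move=> [L1 [u1 m1 <-]] [L2 [u2 m2 <-]]; congr (_ %:Z)%R.
apply: perm_size; apply: uniq_perm => // x.
by apply/idP/idP => [/m1/m2|/m2/m1].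
Qed.

Lemma has_card_sum (X T : eqType) (S : seq X) (P : X -> T -> Prop)
    (F : X -> int) :
    uniq S -> (forall x, x \in S -> has_card (P x) (F x)) ->
  has_card (fun p : X * T => p.1 \in S /\ P p.1 p.2) (\sum_(x <- S) F x)%R.
Proof.
elim: S => [_ _|x S IH /= /andP[xS uS] cP].
  by exists [::]; split=> //= [p|]; [split=> // -[] | rewrite big_nil].
have [L [uL mL sL]] := cP x (mem_head x S).
have /(IH uS)[K [uK mK sK]] : forall y, y \in S -> has_card (P y) (F y).
  by move=> y yS; apply: cP; rewrite inE yS orbT.
exists ([seq (x, y) | y <- L] ++ K); split.
- rewrite cat_uniq uK map_inj_uniq ?uL; last by move=> y z [].
  rewrite andbT; apply/hasPn => p /mK[pS _]; apply/negP => /mapP[y _ Ep].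
  by rewrite Ep /= (negPf xS) in pS.
- move=> [y z]; rewrite mem_cat /= inE; split.
    case/orP=> [/mapP[w wL [-> ->]]|/mK /= [yS Pyz]].
      by rewrite eqxx; split=> //; apply/mL.
    by rewrite yS orbT.
  case=> /orP[/eqP -> Pz|yS Pyz]; apply/orP.
    by left; apply: map_f; apply/mL.
  by right; apply/mK.
- by rewrite big_cons size_cat size_map PoszD sL sK.
Qed.

Lemma has_card_pair (X T : eqType) (P : X -> Prop) (Q : T -> Prop) z1 z2 :
    has_card P z1 -> has_card Q z2 ->
  has_card (fun p : X * T => P p.1 /\ Q p.2) (z1 * z2)%R.
Proof.
move=> [L [uL mL <-]] cQ.
have := @has_card_sum _ _ L (fun _ => Q) (fun _ => z2) uL (fun _ _ => cQ).
rewrite big_const_seq count_predT iter_addr_0 -mulr_natl natz.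
by move/has_card_iff; apply=> p; rewrite mL.
Qed.

Lemma has_card_filter (T : eqType) (P : T -> Prop) (a : pred T) z :
  has_card P z -> exists z', has_card (fun x => P x /\ a x) z'.
Proof.
move=> [L [uL mL _]]; exists (size (filter a L))%:Z%R, (filter a L).
split=> //; first exact: filter_uniq.
by move=> x; rewrite mem_filter -mL; split=> [/andP[]|[-> ->]].
Qed.

Lemma has_card_filterC (T : eqType) (P : T -> Prop) (a : pred T) z z' :
    has_card P z -> has_card (fun x => P x /\ a x) z' ->
  has_card (fun x => P x /\ ~~ a x) (z - z')%R.
Proof.
move=> [L [uL mL <-]] ca; exists (filter (predC a) L); split.
- exact: filter_uniq.
- by move=> x; rewrite mem_filter /= -mL; split=> [/andP[]|[-> ->]].
have <- : (size (filter a L))%:Z%R = z'.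
  apply: has_card_inj ca; exists (filter a L); split=> //.
    exact: filter_uniq.
  by move=> x; rewrite mem_filter -mL; split=> [/andP[]|[-> ->]].
by have := count_predC a L; rewrite !size_filter; lia.
Qed.

(** * Cards and closed walks *)

Lemma comps_auxSS fuel b :
  comps_aux fuel.+1 b.+1 =
  [seq q :: s | q <- iota 1 b.+1, s <- comps_aux fuel (b.+1 - q)].
Proof. by []. Qed.

Lemma mem_comps_aux fuel b s :
  b <= fuel -> (s \in comps_aux fuel b) = is_ordpart b s.
Proof.
have nil0 r : (r \in [:: [::]]) = is_ordpart 0 r.
  rewrite inE /is_ordpart; case: r => [|x r] //=; apply/esym/negP.
  by case/andP=> /andP[x0 _] /eqP; lia.
elim: fuel b s => [|fuel IH] [|b] s // le_b; try exact: nil0.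
rewrite comps_auxSS.
apply/flatten_mapP/idP => [[q qI /mapP[r rin ->]]|].
  move: qI; rewrite mem_iota => qI; move: rin; rewrite IH; last by lia.
  by rewrite /is_ordpart /= => /andP[-> /eqP ->]; apply/andP; split; lia.
case: s => [|q s] /andP[]; first by [].
move=> /andP[q0 s0] /eqP sb.
 exists q; first by rewrite mem_iota; move: sb => /=; lia.
apply: map_f; move: sb => /= sb; rewrite IH; last by lia.
by apply/andP; split; [exact: s0 | apply/eqP; lia].
Qed.

Lemma uniq_comps_aux fuel b : uniq (comps_aux fuel b).
Proof.
elim: fuel b => [|fuel IH] [|b] //; rewrite comps_auxSS.
apply: (allpairs_uniq_dep (f := cons)) => //; first exact: iota_uniq.
by move=> [? ?] [? ?] /= _ _ [<- <-].
Qed.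

Definition state (b kappa : nat) (q : seq nat) : bool :=
  is_ordpart b q && all (fun x => x <= kappa) q.

Lemma mem_comps_k b kappa q : (q \in comps_k b kappa) = state b kappa q.
Proof. by rewrite mem_filter mem_comps_aux // andbC. Qed.

Lemma uniq_comps_k b kappa : uniq (comps_k b kappa).
Proof. exact/filter_uniq/uniq_comps_aux. Qed.

(* Trivial and throw cards get a common encoding: a card from [q] to [r] is a
   bit telling whether the first part of [q] is thrown, together with the mask
   selecting the parts of [r] in which the remaining parts of [q] sit. When
   nothing is thrown, [sumn q = sumn r] forces [q = r] and the full mask. *)
Definition card : eqType := (bool * bitseq)%type.

Definition step (c : card) (q r : seq nat) : bool :=
  [&& size c.2 == size r, c.1 <= size q & all2 leq (drop c.1 q) (mask c.2 r)].

Lemma all2_leq_sumn s t :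
  all2 leq s t -> sumn s <= sumn t /\ (sumn s = sumn t -> s = t).
Proof.
elim: s t => [|x s IH] [|y t] //= /andP[xy /IH[le_st eq_st]].
split=> [|E]; first by lia.
by rewrite eq_st; [congr cons|]; lia.
Qed.

Lemma sumn_mask_leq m s :
    size m = size s -> all (fun x => 0 < x) s ->
  sumn (mask m s) <= sumn s /\ (sumn (mask m s) = sumn s -> m = nseq (size s) true).
Proof.
elim: m s => [|e m IH] [|x s] //= [/IH{}IH] /andP[x0 /IH[le_ms eq_ms]].
case: e => /=; split=> [|E]; last 1 first.
- by exfalso; clear eq_ms; lia.
- by rewrite leq_add2l.
- by rewrite eq_ms //; move/eqP: E; rewrite eqn_add2l => /eqP.
- by apply: leq_trans le_ms (leq_addl _ _).
Qed.

Lemma all2_leq_refl s : all2 leq s s.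
Proof. by elim: s => //= x s ->; rewrite leqnn. Qed.

Lemma step_false m b q r :
    is_ordpart b q -> is_ordpart b r ->
  step (false, m) q r = (q == r) && (m == nseq (size r) true).
Proof.
case/andP=> _ /eqP sq /andP[r0 /eqP sr]; rewrite /step /= drop0.
apply/idP/idP => [/andP[/eqP szm /all2_leq_sumn[le1 eq1]]|].
  have [le2 eq2] := sumn_mask_leq szm r0.
  have Em : m = nseq (size r) true by apply: eq2; lia.
  by move: eq1; rewrite Em mask_true // => ->; rewrite ?eqxx //; lia.
case/andP=> /eqP -> /eqP ->.
by rewrite size_nseq mask_true // all2_leq_refl eqxx.
Qed.

Lemma all2_size (T U : Type) (r : T -> U -> bool) s t :
  all2 r s t -> size s = size t.
Proof. by elim: s t => [|x s IH] [|y t] //= /andP[_ /IH ->]. Qed.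

Lemma has_card_step b q r :
    is_ordpart b q -> is_ordpart b r ->
  has_card (fun c => step c q r) (n_cards q r)%:Z%R.
Proof.
move=> oq or.
pose L1 : seq card := if q == r then [:: (false, nseq (size r) true)] else [::].
pose S := [set m : (size r).-tuple bool |
  (count id m == (size q).-1) && all2 leq (behead q) (mask m r)].
pose L2 : seq card := if q is _ :: _ then [seq (true, tval m) | m <- enum S] else [::].
exists (L1 ++ L2); split.
- rewrite cat_uniq; apply/and3P; split; first by rewrite /L1; case: ifP.
    apply/hasPn => c; rewrite /L2 /L1; case: (q) => // x q'.
    by case/mapP=> m _ ->; case: ifP.
  rewrite /L2; case: (q) => // ? ?; rewrite map_inj_uniq ?enum_uniq //.
  by move=> m1 m2 [] /val_inj.
- move=> [[] m]; rewrite mem_cat.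
    have -> : ((true, m) \in L1) = false by rewrite /L1; case: ifP.
    rewrite /= /L2 /step /=; case: q oq @L1 @S @L2 => [|x q] oq L1 S L2 /=.
      by rewrite andbF.
    rewrite drop0; split.
      case/mapP=> m'; rewrite mem_enum inE => /andP[_ am] [->].
      by rewrite size_tuple eqxx.
    case/andP=> szm am; apply/mapP; exists (Tuple szm) => //.
    rewrite mem_enum inE /= am andbT.
    by rewrite (all2_size am) size_mask //; apply/eqP.
  rewrite (step_false _ oq or).
  have -> : ((false, m) \in L2) = false.
    by rewrite /L2; case: (q) => // ? ?; apply/mapP => -[].
  by rewrite orbF /L1; case: ifP; rewrite ?in_nil // inE.
- rewrite size_cat /n_cards /L1 /L2 /n_embed; congr (Posz (_ + _)).
    by case: ifP.
  case: q oq @L1 @S @L2 => // x q oq L1 S L2.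
  by rewrite size_map -cardE.
Qed.

Definition link : eqType := (seq nat * card)%type.

(* A walk is the list of its states, each with the card leaving it; the final
   state [v] is not recorded. *)
Definition start (v : seq nat) (W : seq link) : seq nat := head v (unzip1 W).

Fixpoint walk (b kappa : nat) (v : seq nat) (W : seq link) : bool :=
  if W is x :: W' then
    [&& state b kappa x.1, step x.2 x.1 (start v W') & walk b kappa v W']
  else true.

Lemma start_state b kappa v W :
  state b kappa v -> walk b kappa v W -> state b kappa (start v W).
Proof. by case: W => //= x W _ /andP[]. Qed.

Lemma has_card_walk b kappa n (i j : 'I_(size (comps_k b kappa))) :
  let st (k : 'I__) := nth [::] (comps_k b kappa) k in
  has_card (fun W => [/\ size W = n, walk b kappa (st j) W & start (st j) W = st i])
           ((Amx b kappa ^+ n)%R i j).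
Proof.
move=> st.
have st_state k : state b kappa (st k) by rewrite -mem_comps_k mem_nth.
have st_inj k l : st k = st l -> k = l.
  by move/eqP; rewrite nth_uniq ?uniq_comps_k // => /eqP/val_inj.
elim: n i => [|n IH] i.
  rewrite expr0 mxE.
  case: eqP => [->|ne].
    by exists [:: [::]]; split=> // -[|x W]; rewrite ?inE //=; split=> // -[].
  exists [::]; split=> // -[|x W]; rewrite ?in_nil; split=> // -[] //= _ _.
  by move/st_inj => E; case: ne.
rewrite exprS mxE.
have cardj k : k \in enum 'I_(size (comps_k b kappa)) ->
  has_card (fun p : card * seq link => step p.1 (st i) (st k) /\
    [/\ size p.2 = n, walk b kappa (st j) p.2 & start (st j) p.2 = st k])
    ((Amx b kappa) i k * (Amx b kappa ^+ n) k j)%R.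
  move=> _; have /andP[oi _] := st_state i; have /andP[ok _] := st_state k.
  by have := has_card_pair (has_card_step oi ok) (IH k); rewrite !mxE.
have := has_card_sum (enum_uniq _) cardj.
rewrite big_enum /= => /(has_card_image (f := fun p => (st i, p.2.1) :: p.2.2)).
apply.
- move=> [k [c W]] [l [d V]] /= [_ [_ [_ _ E1]]] [_ [_ [_ _ E2]]] [E3 E4].
  by rewrite E3 E4; have /st_inj -> : st k = st l by rewrite -E1 -E2 E4.
- case=> [|[q c] W] /=; first by split=> [[]|[]].
  split.
    case=> -[szW] /and3P[sq sc wW] Eq; rewrite /start /= in Eq.
    have := start_state (st_state j) wW; rewrite -mem_comps_k => /(nthP [::])[k ltk Ek].
    exists (Ordinal ltk, (c, W)); last by rewrite /= Eq.
    by rewrite /= mem_enum /st /= Ek -/(st i) -Eq.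
  case=> -[k [d V]] /= [_ [sd [szV wV Ek]]] [-> -> ->].
  by rewrite szV wV Ek sd st_state.
Qed.

Definition closed_walk (b kappa n : nat) (W : seq link) : Prop :=
  size W = n /\ walk b kappa (start [::] W) W.

Lemma has_card_closed_walk b kappa n :
  0 < n -> has_card (closed_walk b kappa n) (trA b kappa n).
Proof.
move=> n_gt0; rewrite /trA /mxtrace.
have := has_card_sum (enum_uniq _)
  (fun i (_ : i \in enum 'I_(size (comps_k b kappa))) => has_card_walk n i i).
rewrite big_enum => /(has_card_image (f := snd)); apply.
- move=> [i V] [j W] /= [_ [sV _ Ei]] [_ [_ _ Ej]] E; move: E Ei Ej => <-.
  case: V sV => [E0|x V _]; first by rewrite -E0 in n_gt0.
  rewrite /start /= => -> /eqP.
  by rewrite nth_uniq ?uniq_comps_k // => /eqP/val_inj ->.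
move=> W; split.
  case=> sW wW; have nW : W <> [::] by move=> E; rewrite -sW E in n_gt0.
  case: W sW wW nW => // x W sW /= /andP[sx wW] _.
  have := sx; rewrite -mem_comps_k => /(nthP [::])[k ltk Ek].
  exists (Ordinal ltk, x :: W) => //=; rewrite mem_enum; split=> //.
  by rewrite Ek sx.
case=> -[i V] /= [_ [sV wV Ei]] ->; split=> //.
case: V sV wV Ei => [E0|x V _ wV Ei]; first by rewrite -E0 in n_gt0.
by rewrite -Ei in wV.
Qed.

(** * Periodic sequences *)

Definition per (T : Type) (x0 : T) (s : seq T) (t : nat) : T :=
  nth x0 s (t %% size s).

Lemma per_mod (T : Type) (x0 : T) s t u :
  t = u %[mod size s] -> per x0 s t = per x0 s u.
Proof. by rewrite /per => ->. Qed.

Lemma perD (T : Type) (x0 : T) s t : per x0 s (t + size s) = per x0 s t.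
Proof. by apply: per_mod; rewrite modnDr. Qed.

Lemma per_small (T : Type) (x0 : T) s t : t < size s -> per x0 s t = nth x0 s t.
Proof. by move=> lt_t; rewrite /per modn_small. Qed.

Lemma period_modn (T : Type) (f : nat -> T) n :
  (forall t, f (t + n) = f t) -> forall t, f t = f (t %% n).
Proof.
move=> fD t; rewrite [in LHS](divn_eq t n) addnC.
by elim: (t %/ n) => [|k IH]; rewrite ?addn0 // mulSn addnCA addnC fD.
Qed.

Lemma per_mkseq (T : Type) (x0 : T) (x : nat -> T) n t :
  0 < n -> (forall t, x (t + n) = x t) -> per x0 (mkseq x n) t = x t.
Proof.
move=> n_gt0 xD; rewrite /per size_mkseq nth_mkseq ?ltn_pmod //.
by rewrite -period_modn.
Qed.

Lemma mkseq_per (T : Type) (x0 : T) s : mkseq (per x0 s) (size s) = s.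
Proof.
apply: (@eq_from_nth _ x0); rewrite size_mkseq // => i lt_i.
by rewrite nth_mkseq // per_small.
Qed.

Lemma all_perP (T : Type) (x0 : T) (s : seq T) (a : pred T) :
  0 < size s -> reflect (forall t, a (per x0 s t)) (all a s).
Proof.
move=> s_gt0; apply: (iffP (all_nthP x0)) => [H t|H t lt_t].
  by apply: H; rewrite ltn_pmod.
by rewrite -per_small.
Qed.

Definition link0 : link := ([::], (false, [::])).

Definition pwalk (b kappa n : nat) (x : nat -> link) : Prop :=
  [/\ forall t, x (t + n) = x t, forall t, state b kappa (x t).1 &
      forall t, step (x t).2 (x t).1 (x t.+1).1].

Lemma walkP b kappa v W :
  reflect (forall t, t < size W -> state b kappa (nth link0 W t).1 /\
             step (nth link0 W t).2 (nth link0 W t).1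
                  (if t.+1 < size W then (nth link0 W t.+1).1 else v))
          (walk b kappa v W).
Proof.
elim: W => [|x W IH] /=; first by apply: ReflectT.
have -> : start v W = if 0 < size W then (nth link0 W 0).1 else v by case: (W).
apply: (iffP and3P) => [[sx cx /IH wW] [|t]|H] //=.
- by rewrite !ltnS => lt_t; apply: wW.
- have [sx cx] := H 0 isT; split=> //; apply/IH => t lt_t.
  exact: (H t.+1).
Qed.

Lemma closed_walkP b kappa n W :
  0 < n ->
  closed_walk b kappa n W <-> size W = n /\ pwalk b kappa n (per link0 W).
Proof.
move=> n_gt0; rewrite /closed_walk.
have st0 : start [::] W = (nth link0 W 0).1 by case: W.
have nextE t : t < size W ->
    (per link0 W t.+1).1 =
    if t.+1 < size W then (nth link0 W t.+1).1 else start [::] W.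
  move=> lt_t; case: ifP => [lt_t1|ge_t1]; first by rewrite per_small.
  have -> : t.+1 = size W by lia.
  by rewrite st0 /per modnn.
split=> -[szW].
  move/walkP => wW; split=> //.
  have perE t : exists2 u, u < size W &
      per link0 W t = per link0 W u /\ per link0 W t.+1 = per link0 W u.+1.
    exists (t %% size W); first by rewrite ltn_pmod // szW.
    split; apply: per_mod; first by rewrite modn_mod.
    by rewrite -[in RHS]addn1 modnDml addn1.
  split=> t; first by rewrite -szW perD.
    by have [u lt_u [-> _]] := perE t; have [] := wW u lt_u; rewrite per_small.
  have [u lt_u [-> ->]] := perE t; have [_] := wW u lt_u.
  by rewrite nextE // per_small.
case=> _ sx cx; split=> //; apply/walkP => t lt_t.
by rewrite -nextE // -per_small.
Qed.

(** * Landing tables of walks *)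

(* [nlanded x s t] counts the parts of the state at time [t] that land during
   the [s] beats [t], ..., [t + s - 1]; they form a prefix of that state. *)
Fixpoint nlanded (x : nat -> link) (s t : nat) : nat :=
  if s is s'.+1 then
    (x t).2.1 + count id (take (nlanded x s' t.+1) (x t).2.2)
  else 0.

Definition lands (x : nat -> link) (s t : nat) : bool :=
  nlanded x s t < nlanded x s.+1 t.

Definition expand (x : nat -> link) (t s : nat) : nat :=
  if lands x s t then nth 0 (x t).1 (nlanded x s t) else 0.

Definition compress (B : nat) (sg : nat -> nat -> nat) (t : nat) : link :=
  ([seq sg t s | s <- iota 0 B & sg t s != 0],
   (sg t 0 != 0, [seq sg t s.+1 != 0 | s <- iota 0 B & sg t.+1 s != 0])).

Definition dense (b kappa n : nat) (sg : nat -> nat -> nat) : Prop :=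
  [/\ forall t s, sg (t + n) s = sg t s,
      forall t s, b * n <= s -> sg t s = 0,
      forall t, \sum_(s < b * n) sg t s = b,
      forall t s, sg t s <= kappa &
      forall t s, sg t s.+1 <= sg t.+1 s].

Definition frozen (x : nat -> link) : Prop := forall t, last false (x t).2.2.

Lemma count_take_leq (T : Type) (a : pred T) k s : count a (take k s) <= count a s.
Proof. by rewrite -[in leqRHS](cat_take_drop k s) count_cat leq_addr. Qed.

Lemma count_takeS k m : count id (take k.+1 m) = count id (take k m) + nth false m k.
Proof.
have [lt_k|ge_k] := ltnP k (size m).
  by rewrite (take_nth false) // -cats1 count_cat /= addn0.
by rewrite !take_oversize ?nth_default ?addn0 //; lia.
Qed.

Lemma last_count m : last false m -> 0 < count id m.
Proof.
elim/last_ind: m => // m x _; rewrite last_rcons -cats1 count_cat /=.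
by case: x; lia.
Qed.

Lemma last_drop (T : Type) (x : T) k s : k < size s -> last x (drop k s) = last x s.
Proof.
move=> lt_k; rewrite -[in RHS](cat_take_drop k s) last_cat.
by case E: (drop k s) => //; move/(congr1 size): E; rewrite size_drop /=; lia.
Qed.

Lemma nth_mask (T : Type) (x0 : T) m s k :
  nth false m k -> nth x0 (mask m s) (count id (take k m)) = nth x0 s k.
Proof.
elim: m s k => [|e m IH] [|x s] [|k] //=; rewrite ?nth_nil //.
- by case: e.
- by case: e => /= /IH.
Qed.

Lemma iota_rcons m k : iota m k.+1 = rcons (iota m k) (m + k).
Proof. by rewrite -addn1 iotaD cats1. Qed.

Lemma filter_rcons (T : Type) (a : pred T) s x :
  filter a (rcons s x) = if a x then rcons (filter a s) x else filter a s.
Proof. by rewrite -cats1 filter_cat /=; case: (a x); rewrite ?cats0 ?cats1. Qed.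

Section Expand.
Variables (b kappa n : nat) (x : nat -> link).
Hypothesis wx : pwalk b kappa n x.
Local Notation q t := (x t).1.
Local Notation e t := (x t).2.1.
Local Notation m t := (x t).2.2.
Local Notation c s t := (nlanded x s t).

Lemma size_mask_state t : size (m t) = size (q t.+1).
Proof. by have [_ _ /(_ t)/and3P[/eqP]] := wx. Qed.

Lemma count_mask_state t : e t + count id (m t) = size (q t).
Proof.
have [_ _ /(_ t)/and3P[/eqP sm le_e /all2_size]] := wx.
by rewrite size_drop size_mask // => <-; rewrite subnKC.
Qed.

Lemma state_parts t i : i < size (q t) -> 0 < nth 0 (q t) i <= kappa.
Proof.
have [_ /(_ t)/andP[/andP[/(all_nthP 0) q0 _] /(all_nthP 0) qk] _] := wx.
by move=> lt_i; rewrite q0 ?qk.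
Qed.

Lemma sumn_state t : sumn (q t) = b.
Proof. by have [_ /(_ t)/andP[/andP[_ /eqP]]] := wx. Qed.

Lemma size_state_leq t : size (q t) <= b.
Proof.
have [_ /(_ t)/andP[/andP[q0 /eqP <-] _] _] := wx.
by elim: (q t) q0 => //= y s IH /andP[y0 /IH]; lia.
Qed.

Lemma nlanded_leq s t : c s t <= size (q t).
Proof.
case: s => //= s; rewrite -count_mask_state leq_add2l.
exact: count_take_leq.
Qed.

Lemma nlanded_step s t : c s t <= c s.+1 t <= (c s t).+1.
Proof.
elim: s t => [|s IH] t; first by rewrite /= take0 /=; case: (e t).
rewrite -[c s.+1 t]/(e t + count id (take (c s t.+1) (m t))).
rewrite -[c s.+2 t]/(e t + count id (take (c s.+1 t.+1) (m t))).
have := IH t.+1; set k := c s _; set l := c s.+1 _ => kl.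
have [->|->] : l = k \/ l = k.+1 by lia.
  by rewrite leqnn leqnSn.
by rewrite count_takeS; case: nth; lia.
Qed.

Lemma landsE s t : c s.+1 t = c s t + lands x s t.
Proof. by have := nlanded_step s t; rewrite /lands; case: ltnP; lia. Qed.

Lemma lands0 t : lands x 0 t = e t.
Proof. by rewrite /lands /= take0 /=; case: (e t). Qed.

Lemma landsS s t : lands x s.+1 t = lands x s t.+1 && nth false (m t) (c s t.+1).
Proof.
rewrite {1}/lands.
rewrite -[c s.+1 t]/(e t + count id (take (c s t.+1) (m t))).
rewrite -[c s.+2 t]/(e t + count id (take (c s.+1 t.+1) (m t))).
rewrite landsE; case: (lands x s t.+1); rewrite ?addn0 ?ltnn //.
by rewrite addn1 count_takeS /=; case: nth; lia.
Qed.

Lemma lands_lt s t : lands x s t -> c s t < size (q t).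
Proof. by move=> lt_s; apply: leq_trans (nlanded_leq s.+1 t). Qed.

Lemma expand_neq0 t s : (expand x t s != 0) = lands x s t.
Proof.
rewrite /expand; case: ifP => // /lands_lt /state_parts; lia.
Qed.

Lemma expand_prefix t s :
  [seq expand x t i | i <- iota 0 s & expand x t i != 0] = take (c s t) (q t).
Proof.
elim: s => [|s IH]; first by rewrite take0.
rewrite iota_rcons filter_rcons add0n expand_neq0 landsE.
case: ifP => [ld|_]; last by rewrite addn0.
rewrite map_rcons IH addn1 (take_nth 0) ?lands_lt //.
by rewrite /expand ld.
Qed.

Lemma expand_mask t s :
  [seq expand x t i.+1 != 0 | i <- iota 0 s & expand x t.+1 i != 0] =
  take (c s t.+1) (m t).
Proof.
elim: s => [|s IH]; first by rewrite take0.
rewrite iota_rcons filter_rcons add0n expand_neq0 landsE.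
case: ifP => [ld|_]; last by rewrite addn0.
rewrite map_rcons IH addn1 (take_nth false) ?size_mask_state ?lands_lt //.
by rewrite expand_neq0 landsS ld.
Qed.

Lemma sum_expand t s : \sum_(i < s) expand x t i = sumn (take (c s t) (q t)).
Proof.
rewrite -expand_prefix -(big_mkord xpredT (expand x t)).
rewrite sumnE big_map big_filter /index_iota subn0.
by rewrite [RHS]big_mkcond /=; apply: eq_bigr => i _; case: eqP => //= ->.
Qed.

Lemma expand_leq_kappa t s : expand x t s <= kappa.
Proof. by rewrite /expand; case: ifP => // /lands_lt /state_parts /andP[]. Qed.

Lemma all2_nth (s r : seq nat) i :
  all2 leq s r -> nth 0 s i <= nth 0 r i.
Proof. by elim: s r i => [|y s IH] [|z r] [|i] //= /andP[? /IH]. Qed.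

Lemma expand_shift t s : expand x t s.+1 <= expand x t.+1 s.
Proof.
rewrite /expand landsS; case: ifP => //= /andP[-> mk].
have [_ _ /(_ t)/and3P[_ _ /all2_nth]] := wx.
move=> /(_ (count id (take (c s t.+1) (m t)))).
by rewrite nth_drop nth_mask.
Qed.

Lemma nlanded_period s t : c s (t + n) = c s t.
Proof.
elim: s t => //= s IH t; rewrite -addSn IH.
by have [-> _ _] := wx.
Qed.

Lemma frozen_nlanded s t : frozen x -> c s t < size (q t).
Proof.
move=> fx; rewrite -count_mask_state; elim: s t => [|s IH] t /=.
  by rewrite addn_gt0 (last_count (fx t)) orbT.
rewrite ltn_add2l.
have lt_k : c s t.+1 < size (m t) by rewrite size_mask_state -count_mask_state.
rewrite -[in ltnRHS](cat_take_drop (c s t.+1) (m t)) count_cat.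
by rewrite -addn1 leq_add2l last_count // last_drop.
Qed.

Lemma nlanded_homo s1 s2 t : s1 <= s2 -> c s1 t <= c s2 t.
Proof.
move=> /subnKC <-; elim: (s2 - s1) => [|k IH]; first by rewrite addn0.
by rewrite addnS (leq_trans IH) //; have /andP[] := nlanded_step (s1 + k) t.
Qed.

Lemma lands_ge s0 s t : c s0 t = size (q t) -> s0 <= s -> lands x s t = false.
Proof.
move=> full le_s; apply/negbTE; rewrite -leqNgt.
by rewrite (leq_trans (nlanded_leq _ _)) // -full nlanded_homo.
Qed.

Hypothesis n_gt0 : 0 < n.

Lemma period_mono (f : nat -> nat) :
  (forall t, f (t + n) = f t) -> (forall t, f t <= f t.+1) ->
  forall t u, f t = f u.
Proof.
move=> fD fS.
have mono t k : f t <= f (t + k).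
  by elim: k => [|k IH]; rewrite ?addn0 // addnS (leq_trans IH).
have const t : f t.+1 = f t.
  apply/eqP; rewrite eqn_leq fS -[f t]fD andbT.
  have -> : t + n = t.+1 + n.-1 by lia.
  exact: mono.
have const0 t : f t = f 0 by elim: t => // t <-.
by move=> t u; rewrite !const0.
Qed.

(* The counts stop growing after at most [b * n] levels, since their sum over a
   period is at most [b * n]. In the stable regime the numbers of parts that
   never land are nondecreasing in time, hence constant; if positive, the masks
   are full beyond the landing parts, so their last bits are set. *)
Lemma nlanded_stable :
  ~ frozen x -> forall t, c (b * n) t = size (q t).
Proof.
move=> nfx.
pose stable s := forall t, c s.+1 t = c s t.
have stableS s : stable s -> stable s.+1 
  by move=> st t; rewrite -[LHS]/(e t + count id (take (c s.+1 t.+1) (m t))) st.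
have alt s : s <= \sum_(t < n) c s t \/ stable s.
  elim: s => [|s [le_s|st_s]]; [by left | | by right; apply: stableS].
  have [/forallP st|] := boolP [forall t : 'I_n, c s.+1 t == c s t].
    right; apply: stableS => t.
    have ltn : t %% n < n by rewrite ltn_pmod.
    rewrite !(period_modn (nlanded_period _) t); apply/eqP/(st (Ordinal ltn)).
  rewrite negb_forall => /existsP[t0 ne_t0]; left.
  apply: (leq_ltn_trans le_s); rewrite (bigD1 t0) //= [ltnRHS](bigD1 t0) //=.
  rewrite -addSn leq_add //; last first.
    by apply: leq_sum => i _; have /andP[] := nlanded_step s i.
  by have /andP[+ _] := nlanded_step s t0; rewrite ltn_neqAle eq_sym ne_t0.
have perc s : (forall t : 'I_n, c s t = size (q t)) -> forall t, c s t = size (q t).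
  move=> H t; have ltn : t %% n < n by rewrite ltn_pmod.
  have [xD _ _] := wx.
  rewrite (period_modn (nlanded_period s) t) (period_modn xD t).
  exact: (H (Ordinal ltn)).
case: (alt (b * n)) => [le_bn|st].
  apply: perc => t.
  have /eqP : \sum_(t < n) (b - c (b * n) t) = 0.
    rewrite sumnB; last first.
      by move=> i _; apply: leq_trans (nlanded_leq _ _) (size_state_leq _).
    by rewrite sum_nat_const card_ord mulnC; apply/eqP; rewrite subn_eq0.
  rewrite sum_nat_eq0 => /forallP/(_ t); rewrite implyTb subn_eq0 => le_b.
  apply/eqP; rewrite eqn_leq nlanded_leq.
  exact: leq_trans (size_state_leq t) le_b.
pose dl t := size (q t) - c (b * n) t.
have dlE t : dl t = count id (drop (c (b * n) t.+1) (m t)).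
  rewrite /dl -st /= -count_mask_state subnDl.
  by rewrite -[X in count id X - _](cat_take_drop (c (b * n) t.+1) (m t)) count_cat addKn.
have dlS t : dl t <= dl t.+1.
  by rewrite dlE (leq_trans (count_size _ _)) // size_drop size_mask_state.
have dlD t : dl (t + n) = dl t by rewrite /dl nlanded_period; have [-> _ _] := wx.
have dl_const := period_mono dlD dlS.
have [dl0|dl0] := posnP (dl 0).
  move=> t; have := dl_const t 0; have := nlanded_leq (b * n) t.
  by rewrite dl0 /dl; lia.
case: nfx => t.
set k := c (b * n) t.+1.
have lt_k : k < size (m t).
  by rewrite size_mask_state /k; have := dl_const t.+1 0; rewrite /dl in dl0 *; lia.
have /allP alld : all id (drop k (m t)).
  by rewrite all_count -dlE (dl_const t t.+1) size_drop size_mask_state.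
rewrite -(last_drop _ lt_k) -nth_last; apply: alld; apply: mem_nth.
by rewrite size_drop; lia.
Qed.

Lemma dense_expand : ~ frozen x -> dense b kappa n (expand x).
Proof.
move=> nfx; have full := nlanded_stable nfx; split.
- move=> t s; rewrite /expand /lands !nlanded_period.
  by have [-> _ _] := wx.
- by move=> t s le_s; rewrite /expand (lands_ge (full t)).
- by move=> t; rewrite sum_expand full take_size sumn_state.
- exact: expand_leq_kappa.
- exact: expand_shift.
Qed.

Lemma expandK t : ~ frozen x -> compress (b * n) (expand x) t = x t.
Proof.
move=> nfx; rewrite /compress expand_prefix expand_mask expand_neq0 lands0.
rewrite !nlanded_stable // -size_mask_state !take_size.
by case: (x t) => ? [].
Qed.

End Expand.

Section Compress.
Variables (b kappa n : nat) (sg : nat -> nat -> nat).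
Hypothesis dsg : dense b kappa n sg.
Local Notation B := (b * n).
Local Notation x := (compress B sg).

Lemma filter_iotaS (a : pred nat) s :
  [seq i <- iota 0 s.+1 | a i] =
  (if a 0 then [:: 0] else [::]) ++ [seq i.+1 | i <- iota 0 s & a i.+1].
Proof.
rewrite /= -[1]/(1 + 0) iotaDl filter_map.
by case: (a 0).
Qed.

Lemma count_iotaS (a : pred nat) s :
  count a (iota 0 s.+1) = a 0 + count (fun i => a i.+1) (iota 0 s).
Proof. by rewrite /= -[1]/(1 + 0) iotaDl count_map. Qed.

Lemma dense_shift_neq0 t s : sg t s.+1 != 0 -> sg t.+1 s != 0.
Proof. by case: dsg => _ _ _ _ /(_ t s); lia. Qed.

Lemma filter_shift t l :
  [seq i <- [seq i <- l | sg t.+1 i != 0] | sg t i.+1 != 0] =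
  [seq i <- l | sg t i.+1 != 0].
Proof.
rewrite -filter_predI; apply: eq_filter => i /=.
by have := @dense_shift_neq0 t i; case: eqP => //= _ ->.
Qed.

Lemma compress_step t : step (x t).2 (x t).1 (x t.+1).1.
Proof.
have [_ sg0 _ _ sgS] := dsg.
have qE : (x t).1 = (if sg t 0 != 0 then [:: sg t 0] else [::]) ++
    [seq sg t s.+1 | s <- iota 0 B & sg t s.+1 != 0].
  transitivity [seq sg t s | s <- iota 0 B.+1 & sg t s != 0].
    by rewrite iota_rcons filter_rcons add0n sg0.
  rewrite (filter_iotaS (fun s => sg t s != 0)) map_cat -map_comp.
  by case: ifP.
rewrite /step qE /= !size_map eqxx /= size_cat.
apply/andP; split; first by case: ifP.
set l := [seq sg t s.+1 | s <- _ & _].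
have -> : drop (sg t 0 != 0) ((if sg t 0 != 0 then [:: sg t 0] else [::]) ++ l) = l.
  by case: ifP => _ /=; rewrite drop0.
rewrite -map_mask -filter_mask filter_shift /l.
elim: [seq _ <- _ | _] => //= i s ->; rewrite andbT; exact: sgS.
Qed.

Lemma pwalk_compress : pwalk b kappa n x.
Proof.
have [sgD sg0 sgb sgk sgS] := dsg; split.
- move=> t; rewrite /compress -addSn.
  congr (_, (_, _)); rewrite ?sgD //.
    by rewrite (eq_filter (a2 := fun s => sg t s != 0)) => [|s]; [apply: eq_map => s|];
      rewrite sgD.
  rewrite (eq_filter (a2 := fun s => sg t.+1 s != 0)) => [|s]; last by rewrite sgD.
  by apply: eq_map => s; rewrite sgD.
- move=> t; rewrite /state /is_ordpart; apply/andP; split; last first.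
    by apply/allP => y /mapP[s _ ->].
  apply/andP; split.
    by apply/allP => y /mapP[s]; rewrite mem_filter => /andP[? _] ->; lia.
  rewrite /= sumnE big_map big_filter -[in eqbRHS](sgb t).
  rewrite -(big_mkord xpredT (sg t)) /index_iota subn0.
  by rewrite big_mkcond /=; apply/eqP/eq_bigr => s _; case: eqP => //= ->.
- exact: compress_step.
Qed.

Lemma nlanded_compress s t :
  s <= B -> nlanded x s t = count (fun i => sg t i != 0) (iota 0 s).
Proof.
elim: s t => // s IH t lt_s; rewrite count_iotaS.
rewrite [LHS]/= IH; last exact: ltnW.
congr (_ + _).
rewrite -(subnKC (ltnW lt_s)) iotaD filter_cat map_cat take_size_cat; last first.
  by rewrite size_map size_filter.
by rewrite count_map -[LHS]size_filter -size_filter -[in RHS]filter_shift.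
Qed.

Lemma nlanded_compress_full t : nlanded x B t = size (x t).1.
Proof. by rewrite nlanded_compress // size_map size_filter. Qed.

Lemma compress_not_frozen : ~ frozen x.
Proof.
move=> fx; have := frozen_nlanded pwalk_compress B 0 fx.
by rewrite nlanded_compress_full ltnn.
Qed.

Lemma compressK t s : expand x t s = sg t s.
Proof.
have [_ sg0 _ _ _] := dsg.
have [le_s|lt_s] := leqP B s.
  by rewrite sg0 // /expand (lands_ge pwalk_compress (nlanded_compress_full t)).
rewrite /expand /lands !nlanded_compress ?(ltnW lt_s) //.
rewrite iota_rcons add0n -cats1 count_cat /= addn0.
case: (posnP (sg t s)) => [->|sg_gt0]; first by rewrite addn0 ltnn.
rewrite /= addn1 ltnSn.
rewrite -(subnKC (ltnW lt_s)) iotaD filter_cat map_cat nth_cat.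
rewrite size_map size_filter ltnn subnn add0n.
by rewrite -(prednK (n := B - s)) ?subn_gt0 //= -lt0n sg_gt0.
Qed.

End Compress.

(** * Landing tables of siteswaps *)

(* [air B n M t s] counts the balls thrown before time [t] that land at time
   [t + s]; multiplying by [n.-1] is negation modulo the period [n]. *)
Definition air (B n : nat) (M : nat -> seq nat) (t s : nat) : nat :=
  \sum_(j < B) count_mem (s + j.+1) (M (t + j.+1 * n.-1)).

Definition toss (B : nat) (sg : nat -> nat -> nat) (t : nat) : seq nat :=
  sort leq (flatten [seq nseq (sg t.+1 s - sg t s.+1) s.+1 | s <- iota 0 B]).

Definition heights_in (B : nat) (m : seq nat) : bool := all (fun h => 0 < h <= B) m.

Lemma sum_by_value B m (F : nat -> nat) :
  heights_in B m -> \sum_(h <- m) F h = \sum_(j < B) F j.+1 * count_mem j.+1 m.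
Proof.
elim: m => [|h m IH] /=.
  by rewrite big_nil big1 // => j _; rewrite muln0.
case/andP=> /andP[h_gt0 le_h] /IH{}IH; rewrite big_cons IH.
under [RHS]eq_bigr do rewrite mulnDr.
rewrite big_split /=; congr (_ + _).
have lt_h : h.-1 < B by lia.
rewrite (bigD1 (Ordinal lt_h)) //= prednK // eqxx muln1 big1 ?addn0 // => j ne_j.
case: eqP => [E|_]; last by rewrite muln0.
by case/eqP: ne_j; apply: val_inj; rewrite /= E.
Qed.

Lemma count_by_value B m (a : pred nat) :
  heights_in B m -> count a m = \sum_(j < B) a j.+1 * count_mem j.+1 m.
Proof.
move=> hm; rewrite -(sum_by_value (fun h => nat_of_bool (a h)) hm).
by rewrite -sum1_count big_mkcond /=; apply: eq_bigr => h _; case: (a h).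
Qed.

Lemma size_by_value B m :
  heights_in B m -> size m = \sum_(j < B) count_mem j.+1 m.
Proof.
move=> /(count_by_value predT); rewrite count_predT => ->.
by apply: eq_bigr => j _; rewrite mul1n.
Qed.

Lemma sumn_by_value B m :
  heights_in B m -> sumn m = \sum_(j < B) j.+1 * count_mem j.+1 m.
Proof. by move=> hm; rewrite sumnE (sum_by_value id hm). Qed.

Lemma count_mem_heights B m h :
  heights_in B m -> ~~ (0 < h <= B) -> count_mem h m = 0.
Proof.
move=> /allP hm nh; apply/count_memPn.
by apply: contra nh => /hm.
Qed.

Lemma landings_air B n M t :
    t < n -> size M = n -> all (heights_in B) M ->
  landings n M t = air B n (per [::] M) t 0.
Proof.
move=> lt_t szM /(all_nthP [::]) hM; rewrite /landings /air.
under eq_bigr => s _.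
  rewrite (count_by_value _ (hM s _)) ?szM //; over.
rewrite exchange_big /=; apply: eq_bigr => j _.
have n_gt0 : 0 < n by lia.
have lt_s : (t + j.+1 * n.-1) %% n < n by rewrite ltn_pmod.
have addE a : a + j.+1 + j.+1 * n.-1 = a + j.+1 * n by nia.
rewrite (bigD1 (Ordinal lt_s)) //= big1 => [|s ne_s].
  rewrite addn0 add0n /per szM.
  by rewrite modnDml addnAC addE addnC modnMDl modn_small // eqxx mul1n.
case: eqP => // E; case/eqP: ne_s; apply: val_inj => /=.
by rewrite -E modnDml addE addnC modnMDl modn_small.
Qed.

Section Correspondence.
Variables (B n : nat) (M : nat -> seq nat) (sg : nat -> nat -> nat).
Hypothesis n_gt0 : 0 < n.
Hypothesis hM : forall t, heights_in B (M t).
Hypothesis sgD : forall t s, sg (t + n) s = sg t s.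
Hypothesis sg0 : forall t s, B <= s -> sg t s = 0.
Hypothesis sgE : forall t s, sg t.+1 s = count_mem s.+1 (M t) + sg t s.+1.

Lemma sum_shift (f : nat -> nat) :
  f B = 0 -> f 0 + \sum_(s < B) f s.+1 = \sum_(s < B) f s.
Proof. by move=> fB; rewrite -(big_ord_recl B f) big_ord_recr /= fB addn0. Qed.

Lemma size_toss t :
  size (M t) + \sum_(s < B) sg t s = sg t 0 + \sum_(s < B) sg t.+1 s.
Proof.
rewrite (size_by_value (hM t)) -(sum_shift (sg0 t (leqnn B))) addnCA -big_split.
by congr (_ + _); apply: eq_bigr => s _; rewrite sgE.
Qed.

(* The weight [sum_s s * sg t s] changes by the total height thrown minus one
   beat of descent for every ball. *)
Lemma sumn_toss t :
  sumn (M t) + \sum_(s < B) s * sg t s =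
  \sum_(s < B) s * sg t.+1 s + \sum_(s < B) sg t.+1 s.
Proof.
have fB : B * sg t B = 0 by rewrite sg0 ?muln0.
rewrite (sumn_by_value (hM t)) -(sum_shift (f := fun s => s * sg t s) fB).
rewrite mul0n add0n -!big_split; apply: eq_bigr => s _ /=.
by rewrite -mulnDr -sgE mulSn addnC.
Qed.

Lemma sum_period (f : nat -> nat) :
  (forall t, f (t + n) = f t) -> \sum_(t < n) f t.+1 = \sum_(t < n) f t.
Proof.
move=> fD; apply/eqP; rewrite -(eqn_add2l (f 0)) -(big_ord_recl n f).
by rewrite big_ord_recr /= -(fD 0) add0n addnC.
Qed.

Lemma sum_sumn : \sum_(t < n) sumn (M t) = \sum_(t < n) \sum_(s < B) sg t s.
Proof.
apply/eqP; rewrite -(eqn_add2r (\sum_(t < n) \sum_(s < B) s * sg t s)).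
rewrite -big_split /= (eq_bigr _ (fun (t : 'I_n) _ => sumn_toss t)) big_split /=.
rewrite (sum_period (f := fun t => \sum_(s < B) s * sg t s)); last first.
  by move=> t; apply: eq_bigr => s _; rewrite sgD.
rewrite (sum_period (f := fun t => \sum_(s < B) sg t s)) 1?addnC //.
by move=> t; apply: eq_bigr => s _; rewrite sgD.
Qed.

Lemma sg_period k t s : sg (t + k * n) s = sg t s.
Proof. by elim: k => [|k IH]; rewrite ?addn0 // mulSn addnCA addnC sgD. Qed.

Lemma air_unique t s : sg t s = air B n M t s.
Proof.
have H k : sg t s = \sum_(j < k) count_mem (s + j.+1) (M (t + j.+1 * n.-1)) +
                    sg (t + k * n.-1) (s + k).
  elim: k => [|k ->]; first by rewrite big_ord0 !addn0.
  rewrite big_ord_recr /= -addnA; congr (_ + _).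
  rewrite addnS -sgE -(sg_period 1).
  by congr sg; rewrite mul1n mulSn; lia.
by rewrite (H B) sg0 ?addn0 // leq_addl.
Qed.

Lemma sg_leq_base t s : sg t s <= sg (t + s) 0.
Proof.
elim: s t => [|s IH] t; first by rewrite addn0.
rewrite addnS -addSn; apply: leq_trans (IH t.+1).
by rewrite sgE leq_addl.
Qed.

End Correspondence.

Section Air.
Variables (B n : nat) (M : nat -> seq nat).
Hypothesis n_gt0 : 0 < n.
Hypothesis MD : forall t, M (t + n) = M t.
Hypothesis hM : forall t, heights_in B (M t).

Lemma air_period t s : air B n M (t + n) s = air B n M t s.
Proof. by apply: eq_bigr => j _; rewrite addnAC MD. Qed.

Lemma air_ge t s : B <= s -> air B n M t s = 0.
Proof.
move=> le_s; apply: big1 => j _; apply: count_mem_heights (hM _) _; lia.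
Qed.

Lemma air_shift t s : air B n M t.+1 s = count_mem s.+1 (M t) + air B n M t s.+1.
Proof.
transitivity (\sum_(j < B.+1) count_mem (s + j.+1) (M (t.+1 + j.+1 * n.-1))).
  rewrite big_ord_recr /= [X in _ + X](_ : _ = 0) ?addn0 //.
  by apply: count_mem_heights (hM _) _; lia.
rewrite big_ord_recl /=; congr (_ + _).
  rewrite addn1 mul1n -[M t]MD; congr (count _ (M _)).
  by lia.
apply: eq_bigr => j _; rewrite /bump /= !add1n -[M (t + _)]MD.
have -> : s + j.+2 = s.+1 + j.+1 by lia.
congr (count _ (M _)); rewrite mulSn; lia.
Qed.

End Air.

Lemma count_mem_toss B sg t h :
  count_mem h (toss B sg t) = if 0 < h <= B then sg t.+1 h.-1 - sg t h else 0.
Proof.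
rewrite /toss (permP (permEl (perm_sort _ _))).
elim: B => [|B IH]; first by case: ifP => //; lia.
rewrite iota_rcons map_rcons flatten_rcons count_cat IH count_nseq add0n /=.
case: (B.+1 =P h) => [<-|ne].
  by rewrite ltnn leqnn /= mul1n.
by rewrite mul0n addn0 (_ : (h <= B) = (h <= B.+1)) //; lia.
Qed.

Lemma heights_in_toss B sg t : heights_in B (toss B sg t).
Proof.
apply/allP => h; rewrite mem_sort => /flattenP[l /mapP[s]].
by rewrite mem_iota => lt_s -> /nseqP[-> _]; lia.
Qed.

Lemma toss_unique B sg (m : seq nat) t :
    sorted leq m -> heights_in B m ->
    (forall s, s < B -> sg t.+1 s = count_mem s.+1 m + sg t s.+1) ->
  toss B sg t = m.
Proof.
move=> srt_m hm E; apply: (sorted_eq leq_trans anti_leq) => //.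
  exact: sort_sorted leq_total _.
rewrite /perm_eq; apply/allP => h _ /=; rewrite count_mem_toss.
case: ifP => [hB|/negbT nhB]; last by rewrite (count_mem_heights hm).
have Eh : h = h.-1.+1 by lia.
by rewrite E; [rewrite -Eh addnK | lia].
Qed.

Lemma toss_shift b kappa n sg t s :
    dense b kappa n sg ->
  sg t.+1 s = count_mem s.+1 (toss (b * n) sg t) + sg t s.+1.
Proof.
case=> _ sg0 _ _ sgS; rewrite count_mem_toss /=.
case: ifP => [_|nlt]; first by rewrite subnK.
by rewrite !sg0 //; lia.
Qed.

Lemma toss_period b kappa n sg t :
  dense b kappa n sg -> toss (b * n) sg (t + n) = toss (b * n) sg t.
Proof.
case=> sgD _ _ _ _; rewrite /toss; congr (sort _ (flatten _)).
by apply: eq_map => s; rewrite -addSn !sgD.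
Qed.

Lemma leq_sumn (h : nat) m : h \in m -> h <= sumn m.
Proof.
by elim: m => //= x m IH; rewrite inE => /orP[/eqP ->|/IH]; lia.
Qed.

Lemma ss_valid_heights n b kappa M :
  ss_valid n b kappa M -> all (heights_in (b * n)) M.
Proof.
case=> -[szM /allP msM _] <- _; apply/allP => m mM; apply/allP => h hm.
have /andP[_ /allP/(_ _ hm) ->] := msM m mM.
apply: (leq_trans (leq_sumn hm)); move/(nthP [::]): mM => [t lt_t <-].
by rewrite szM in lt_t; rewrite (bigD1 (Ordinal lt_t)) //= leq_addr.
Qed.

Lemma dense_air n b kappa M :
    0 < n -> ss_valid n b kappa M ->
  dense b kappa n (air (b * n) n (per [::] M)).
Proof.
move=> n_gt0 vM; have hMs := ss_valid_heights vM.
case: vM => -[szM msM lM] bM kM; set B := b * n; set Mp := per [::] M.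
have MD t : Mp (t + n) = Mp t by rewrite /Mp -szM perD.
have hM t : heights_in B (Mp t).
  by apply: (elimT (all_perP [::] _ _) hMs); rewrite szM.
have sgD t s : air B n Mp (t + n) s = air B n Mp t s by apply: air_period.
have sg0 t s : B <= s -> air B n Mp t s = 0 by apply: air_ge.
have sgE t s : air B n Mp t.+1 s = count_mem s.+1 (Mp t) + air B n Mp t s.+1.
  exact: air_shift.
have base t : size (Mp t) = air B n Mp t 0.
  rewrite (period_modn (f := fun t => air B n Mp t 0) (n := n)) //.
  rewrite -landings_air ?ltn_pmod // -lM ?ltn_pmod //.
  by rewrite /Mp /per szM.
split=> //.
- have const t : \sum_(s < B) air B n Mp t s = \sum_(s < B) air B n Mp 0 s.
    elim: t => // t <-; have := size_toss hM sg0 sgE t.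
    by rewrite base => /eqP; rewrite eqn_add2l => /eqP.
  move=> t; rewrite const; apply/eqP; rewrite -(eqn_pmul2r n_gt0) -bM.
  rewrite (eq_bigr (fun t : 'I_n => sumn (Mp t))); last first.
    by move=> i _; rewrite /Mp per_small // szM.
  rewrite (sum_sumn hM sgD sg0 sgE) (eq_bigr _ (fun (i : 'I_n) _ => const i)).
  by rewrite sum_nat_const card_ord mulnC.
- move=> t s; apply: leq_trans (sg_leq_base sgE t s) _; rewrite -base.
  by apply: (elimT (all_perP [::] _ _) kM); rewrite szM.
- by move=> t s; rewrite sgE leq_addl.
Qed.

Lemma ss_valid_toss n b kappa sg :
    0 < n -> dense b kappa n sg ->
  ss_valid n b kappa (mkseq (toss (b * n) sg) n).
Proof.
move=> n_gt0 dsg; set B := b * n; set Mp := toss B sg.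
have MD t : Mp (t + n) = Mp t := toss_period t dsg.
have hM t : heights_in B (Mp t) := heights_in_toss B sg t.
have sgE t s := toss_shift t s dsg.
have [sgD sg0 sgb sgk _] := dsg.
have base t : size (Mp t) = sg t 0.
  by have /eqP := size_toss hM sg0 sgE t; rewrite !sgb eqn_add2r => /eqP.
have perE t : per [::] (mkseq Mp n) t = Mp t by apply: per_mkseq.
split; first split.
- by rewrite size_mkseq.
- apply/allP => m /mapP[t _ ->]; rewrite /is_multiset; apply/andP; split.
    exact: sort_sorted leq_total _.
  by apply/allP => h /(allP (hM t)) /andP[].
- move=> t lt_t; rewrite nth_mkseq // base (landings_air (B := B)) ?size_mkseq //.
    rewrite (air_unique n_gt0 sgD sg0 sgE).
    by apply: eq_bigr => j _; rewrite perE.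
  by apply/allP => m /mapP[u _ ->].
- rewrite /has_balls (eq_bigr (fun t : 'I_n => sumn (Mp t))) => [|t _].
    rewrite (sum_sumn hM sgD sg0 sgE) (eq_bigr _ (fun (i : 'I_n) _ => sgb i)).
    by rewrite sum_nat_const card_ord mulnC.
  by rewrite nth_mkseq.
- by apply/allP => m /mapP[t _ ->]; rewrite base.
Qed.

Lemma nlanded_ext x y s t : x =1 y -> nlanded x s t = nlanded y s t.
Proof. by move=> xy; elim: s t => //= s IH t; rewrite xy IH. Qed.

Lemma expand_ext x y t s : x =1 y -> expand x t s = expand y t s.
Proof. by move=> xy; rewrite /expand /lands !(nlanded_ext _ _ xy) xy. Qed.

Lemma toss_ext B sg sg' t : sg =2 sg' -> toss B sg t = toss B sg' t.
Proof.
by move=> E; rewrite /toss; congr (sort _ (flatten _)); apply: eq_map => s; rewrite !E.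
Qed.

Lemma compress_ext B sg sg' t : sg =2 sg' -> compress B sg t = compress B sg' t.
Proof.
move=> E; rewrite /compress E; congr (_, (_, _)).
  rewrite (eq_filter (a2 := fun s => sg' t s != 0)) => [|s]; last by rewrite E.
  by apply: eq_map => s; rewrite E.
rewrite (eq_filter (a2 := fun s => sg' t.+1 s != 0)) => [|s]; last by rewrite E.
by apply: eq_map => s; rewrite E.
Qed.

Definition frozenb (W : seq link) : bool := all (fun l => last false l.2.2) W.

Lemma frozenP W : 0 < size W -> reflect (frozen (per link0 W)) (frozenb W).
Proof. exact: all_perP. Qed.

Lemma closed_walk_mkseq b kappa n x :
  0 < n -> pwalk b kappa n x -> closed_walk b kappa n (mkseq x n).
Proof.
move=> n_gt0 wx; apply/(closed_walkP _ _ _ n_gt0); rewrite size_mkseq; split=> //.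
have [xD sx cx] := wx; have E := per_mkseq link0 _ n_gt0 xD.
by split=> t; rewrite !E.
Qed.

Lemma has_card_siteswap n b kappa z :
    0 < n ->
    has_card (fun W => closed_walk b kappa n W /\ ~~ frozenb W) z ->
  has_card (ss_valid n b kappa) z.
Proof.
move=> n_gt0; set B := b * n.
have nfrz W : closed_walk b kappa n W -> ~~ frozenb W ->
    [/\ size W = n, pwalk b kappa n (per link0 W) & ~ frozen (per link0 W)].
  move=> /(closed_walkP _ _ _ n_gt0)[szW wW] nfW; split=> // /frozenP frW.
  by case/negP: nfW; apply: frW; rewrite szW.
move/(has_card_bij (f := fun W => mkseq (toss B (expand (per link0 W))) n)
  (g := fun M => mkseq (compress B (air B n (per [::] M))) n)); apply.
- move=> W [/nfrz + /[dup] nfW] => /(_ nfW)[szW wW nW] _.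
  exact/ss_valid_toss/dense_expand.
- move=> M vM; have dM := dense_air n_gt0 vM; have wM := pwalk_compress dM.
  split; first exact: closed_walk_mkseq.
  have szW : 0 < size (mkseq (compress B (air B n (per [::] M))) n).
    by rewrite size_mkseq.
  apply/(frozenP szW) => fz.
  apply: (compress_not_frozen dM) => t; have [xD _ _] := wM.
  by have := fz t; rewrite per_mkseq.
- move=> W [/nfrz + /[dup] nfW] => /(_ nfW)[szW wW nW] _.
  have dW := dense_expand wW n_gt0 nW; have [sgD sg0 _ _ _] := dW.
  rewrite -[RHS](mkseq_per link0) szW; apply: eq_mkseq => t.
  rewrite -[RHS](expandK wW n_gt0 _ nW); apply: compress_ext => {}t s.
  rewrite -[LHS]/(air B n _ t s).
  rewrite [RHS](air_unique n_gt0 sgD sg0 (fun u r => toss_shift u r dW)).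
  by apply: eq_bigr => j _; rewrite per_mkseq // => u; apply: toss_period dW.
- move=> M vM; have dM := dense_air n_gt0 vM.
  have [xD _ _] := pwalk_compress dM.
  have hMs := ss_valid_heights vM; case: vM => -[szM msM _] _ _.
  have MD t : per [::] M (t + n) = per [::] M t by rewrite -szM perD.
  have hM t : heights_in B (per [::] M t).
    by apply: (elimT (all_perP [::] _ _) hMs); rewrite szM.
  rewrite -[RHS](mkseq_per [::]) szM; apply: eq_mkseq => t.
  rewrite (@toss_ext B _ (air B n (per [::] M))) => [|u s]; last first.
    rewrite (@expand_ext _ (compress B (air B n (per [::] M)))) => [|v].
      exact: (compressK dM).
    exact: per_mkseq.
  apply: toss_unique => // [|s _]; last exact: air_shift.
  have : is_multiset (per [::] M t).
    by apply: (elimT (all_perP [::] _ _) msM); rewrite szM.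
  by case/andP.
Qed.

(** * Walks with parts that never land *)

Lemma all2_rcons (T U : Type) (r : T -> U -> bool) s t x y :
  all2 r (rcons s x) (rcons t y) = all2 r s t && r x y.
Proof.
elim: s t => [|a s IH] [|c t] //=; rewrite ?andbT //.
- by case: t => [|? ?]; rewrite /= andbF.
- by case: s {IH} => [|? ?]; rewrite /= andbF.
- by rewrite IH andbA.
Qed.

Lemma step_rcons e m q r i j :
  step (e, rcons m true) (rcons q i) (rcons r j) = step (e, m) q r && (i <= j).
Proof.
rewrite /step /= !size_rcons eqSS.
have [sz_mr|] := eqVneq (size m) (size r); last by [].
rewrite mask_rcons //= cats1.
case: e => /=; last by rewrite !drop0 all2_rcons.
case: q => [|a q] /=; last by rewrite !drop0 all2_rcons.
by case: (mask m r).
Qed.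

Lemma state_rcons b kappa q j :
  state b kappa (rcons q j) = [&& 0 < j, j <= kappa, j <= b & state (b - j) kappa q].
Proof.
rewrite /state /is_ordpart !all_rcons sumn_rcons.
case: (0 < j) => //=; case: (j <= kappa) => /=; last by rewrite !andbF.
have [le_jb|lt_bj] := leqP j b; last first.
  rewrite [_ + j == b](_ : _ = false) ?andbF //.
  by apply/negbTE; lia.
by rewrite -{1}(subnK le_jb) eqn_add2r.
Qed.

Definition grow (j : nat) (l : link) : link :=
  (rcons l.1 j, (l.2.1, rcons l.2.2 true)).

Lemma step_grow j l r : step (grow j l).2 (grow j l).1 (rcons r j) = step l.2 l.1 r.
Proof. by case: l => q [e m]; rewrite step_rcons leqnn andbT. Qed.

Lemma grow_inj j : injective (grow j).
Proof. by move=> [q [e m]] [r [f k]] [] /rcons_inj[->] -> /rcons_inj[->]. Qed.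

Lemma per_map (T U : Type) (x0 : T) (y0 : U) (f : T -> U) s t :
  0 < size s -> per y0 (map f s) t = f (per x0 s t).
Proof.
by move=> s_gt0; rewrite /per size_map (nth_map x0) // ltn_pmod.
Qed.

Lemma closed_walk_grow b kappa n j V :
    0 < n ->
  closed_walk b kappa n (map (grow j) V) <->
  [/\ 0 < j, j <= kappa, j <= b & closed_walk (b - j) kappa n V].
Proof.
move=> n_gt0; rewrite closed_walkP //.
have perE : 0 < size V -> per link0 (map (grow j) V) =1 grow j \o per link0 V.
  by move=> V_gt0 t; apply: per_map.
split.
  rewrite size_map => -[szV]; case: (V) szV perE => [E0|]; first by rewrite -E0 in n_gt0.
  move=> l V' szV /(_ isT) perE [_ sx cx].
  have := sx 0; rewrite perE state_rcons => /and4P[j0 jk jb _]; split=> //.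
  apply/closed_walkP => //; split=> //.
  split=> t; first by rewrite -szV perD.
    by have := sx t; rewrite perE state_rcons => /and4P[].
  by have := cx t; rewrite !perE step_grow.
case=> j0 jk jb /(closed_walkP _ _ _ n_gt0)[szV [_ sx cx]]; rewrite size_map; split=> //.
have {}perE := perE (_ : 0 < size V); rewrite szV in perE; have {}perE := perE n_gt0.
split=> t.
- by rewrite !perE /= -szV perD.
- by rewrite perE state_rcons j0 jk jb sx.
- by rewrite !perE step_grow.
Qed.

Lemma rcons_last (T : Type) (x0 : T) s :
  0 < size s -> s = rcons (take (size s).-1 s) (last x0 s).
Proof.
by case/lastP: s => // s x _; rewrite size_rcons /= last_rcons -cats1 take_size_cat ?cats1.
Qed.

Lemma frozen_grow b kappa n W :
    0 < n -> closed_walk b kappa n W -> frozenb W ->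
  exists j V, W = map (grow j) V.
Proof.
move=> n_gt0 /(closed_walkP _ _ _ n_gt0)[szW wx] fz.
have W_gt0 : 0 < size W by rewrite szW.
have fx := elimT (frozenP W_gt0) fz; set x := per link0 W in wx fx.
have q_gt0 t : 0 < size (x t).1 := frozen_nlanded wx 0 t fx.
have m_gt0 t : 0 < size (x t).2.2 by have := fx t; case: (x t).2.2.
pose lst t := last 0 (x t).1.
have lstS t : lst t <= lst t.+1.
  have [_ _ /(_ t)] := wx.
  rewrite [(x t).2]surjective_pairing [(x t).2.2](rcons_last false) // fx.
  rewrite [(x t).1](rcons_last 0) // [(x t.+1).1](rcons_last 0) // step_rcons.
  by case/andP.
have lstD t : lst (t + n) = lst t by rewrite /lst; have [-> _ _] := wx.
have lst_const := period_mono n_gt0 lstD lstS.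
pose V := [seq (take (size l.1).-1 l.1, (l.2.1, take (size l.2.2).-1 l.2.2)) | l <- W].
exists (lst 0), V; rewrite -map_comp -[LHS]map_id.
apply/eq_in_map => l /(nthP link0)[t lt_t <-].
rewrite -per_small // -/(x t) (lst_const 0 t) /grow /=.
rewrite -(rcons_last 0) // -[in rcons _ true](fx t) -(rcons_last false) //.
by case: (x t) => ? [].
Qed.

Lemma has_card_frozen b kappa n :
    0 < n ->
  has_card (fun W => closed_walk b kappa n W /\ frozenb W)
           (\sum_(b - kappa <= i < b) trA i kappa n)%R.
Proof.
move=> n_gt0.
have := has_card_sum (iota_uniq (b - kappa) (b - (b - kappa)))
  (fun i (_ : i \in _) => has_card_closed_walk i kappa n_gt0).
move/(has_card_image (f := fun p => map (grow (b - p.1)) p.2)); apply.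
  move=> [i U] [j V] /= [+ [szU _]] [+ [szV _]].
  rewrite !mem_iota => ib jb E.
  have ij : i = j.
    case: U V szU szV E => [|u U] [|v V] // szU szV; try by rewrite -?szU -?szV in n_gt0.
    by case=> /rcons_inj[_]; lia.
  by move: E; rewrite ij => /(inj_map (@grow_inj _)) ->.
move=> W; split.
  case=> wW /(frozen_grow n_gt0 wW)[j [V EW]].
  move: wW; rewrite EW (closed_walk_grow _ _ _ _ n_gt0) => -[j0 jk jb wV].
  exists (b - j, V); last by rewrite /= subKn.
  by rewrite /= mem_iota; split=> //; lia.
case=> -[i V] /= [+ wV ->]; rewrite mem_iota => ib; split.
  apply/closed_walk_grow => //; have -> : b - (b - i) = i by lia.
  by split=> //; lia.
by rewrite /frozenb all_map; apply/allP => l _ /=; rewrite last_rcons.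
Qed.

Lemma has_card_ss_valid b kappa n :
    0 < n ->
  has_card (ss_valid n b kappa)
           (trA b kappa n - \sum_(b - kappa <= i < b) trA i kappa n)%R.
Proof.
move=> n_gt0; apply: has_card_siteswap => //.
apply: has_card_filterC (has_card_closed_walk b kappa n_gt0) _.
exact: (has_card_frozen b kappa n_gt0).
Qed.

(** * Moebius inversion *)

Lemma mobiusMp p d :
  prime p -> 0 < d -> ~~ (p %| d) -> mobius (p * d) = (- mobius d)%R.
Proof.
move=> pr_p d_gt0 npd; have p_gt0 := prime_gt0 pr_p.
have p_notin : p \notin primes d by rewrite mem_primes pr_p d_gt0.
have prE : perm_eq (primes (p * d)) (p :: primes d).
  apply: uniq_perm; rewrite ?primes_uniq //= ?p_notin ?primes_uniq //.
  by move=> q; rewrite primesM // primes_prime // !inE.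
rewrite /mobius (perm_size prE) (perm_all _ prE) /= exprS mulN1r.
rewrite lognM // logn_prime // eqxx lognE (negPf npd) !andbF /=.
rewrite (eq_in_all (a2 := fun q => logn q d == 1)); last first.
  move=> q q_in; rewrite lognM // logn_prime // [q == p](_ : _ = false) //.
  by apply: contraNF p_notin => /eqP <-.
by case: ifP; rewrite ?oppr0.
Qed.

Lemma mobius_square p d : prime p -> 0 < d -> p ^ 2 %| d -> mobius d = 0%R.
Proof.
move=> pr_p d_gt0; rewrite pfactor_dvdn // => lt1; rewrite /mobius.
case: ifP => // /allP/(_ p); rewrite mem_primes pr_p d_gt0 /=.
have -> : p %| d by rewrite -[p]expn1 pfactor_dvdn //; lia.
by move=> /(_ isT)/eqP E; rewrite E in lt1.
Qed.

(* The divisors of [n] divisible exactly once by the prime [p] are the [p * d]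
   with [d] a divisor prime to [p]; their contributions cancel those of [d]. *)
Lemma sum_mobius n : 0 < n -> (\sum_(d <- divisors n) mobius d = (n == 1)%:R)%R.
Proof.
move=> n_gt0; have [->|n_neq1] := eqVneq n 1.
  by rewrite /divisors /= big_seq1.
have n_gt1 : 1 < n by lia.
have pr_p := pdiv_prime n_gt1; set p := pdiv n in pr_p.
have p_dvd : p %| n by apply: pdiv_dvd.
have p_gt0 := prime_gt0 pr_p.
rewrite (bigID (fun d => p %| d)) /= [X in (X + _)%R](bigID (fun d => p ^ 2 %| d)) /=.
rewrite big_seq_cond big1 ?add0r => [|d]; last first.
  rewrite -dvdn_divisors // => /and3P[dn _].
  exact: (mobius_square pr_p (dvdn_gt0 n_gt0 dn)).
pose D := [seq d <- divisors n | ~~ (p %| d)].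
have permD : perm_eq [seq d <- divisors n | (p %| d) && ~~ (p ^ 2 %| d)]
                     [seq p * d | d <- D].
  apply: uniq_perm; rewrite ?filter_uniq ?divisors_uniq //.
    rewrite map_inj_uniq ?filter_uniq ?divisors_uniq //.
    by move=> x y /eqP; rewrite eqn_pmul2l // => /eqP.
  move=> d; rewrite mem_filter -dvdn_divisors //; apply/andP/mapP.
    case=> /andP[/dvdnP[e ->]]; rewrite -mulnn dvdn_pmul2r // => npe dn.
    exists e; last by rewrite mulnC.
    by rewrite mem_filter npe -dvdn_divisors // (dvdn_trans (dvdn_mulr _ (dvdnn e)) dn).
  case=> e; rewrite mem_filter -dvdn_divisors // => /andP[npe en] ->.
  rewrite dvdn_mulr // -mulnn dvdn_pmul2l // npe; split=> //.
  by rewrite Gauss_dvd ?p_dvd // prime_coprime.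
rewrite -big_filter (perm_big _ permD) big_map -[X in (_ + X)%R]big_filter -/D.
rewrite big_seq (eq_bigr (fun d => - mobius d)%R) => [|d].
  by rewrite -big_seq sumrN addNr.
rewrite mem_filter -dvdn_divisors // => /andP[npd dn].
by apply: mobiusMp => //; apply: dvdn_gt0 dn.
Qed.

Lemma sum_divisors N n (G : nat -> int) :
  0 < n <= N -> (\sum_(d <- divisors n) G d = \sum_(d < N.+1 | (d %| n)%N) G d)%R.
Proof.
case/andP=> n_gt0 le_nN.
have /(perm_big _) -> : perm_eq (divisors n) [seq d <- iota 0 N.+1 | d %| n].
  apply: uniq_perm; rewrite ?divisors_uniq ?filter_uniq ?iota_uniq // => d.
  rewrite -dvdn_divisors // mem_filter mem_iota /= add0n ltnS.
  have [dn|//] := boolP (d %| n).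
  by rewrite (leq_trans (dvdn_leq n_gt0 dn) le_nN).
by rewrite big_filter -(big_mkord (fun d => d %| n)) /index_iota subn0.
Qed.

Lemma sum_divisors_codiv n (G : nat -> int) :
  0 < n -> (\sum_(d <- divisors n) G (n %/ d)%N = \sum_(d <- divisors n) G d)%R.
Proof.
move=> n_gt0; rewrite -(big_map (fun d => n %/ d) xpredT).
have divK d : d \in divisors n -> n %/ (n %/ d) = d.
  by rewrite -dvdn_divisors // => dn; rewrite divnA // mulKn.
apply: perm_big; apply: uniq_perm; rewrite ?divisors_uniq //.
  rewrite map_inj_in_uniq ?divisors_uniq // => x y /divK {2}<- /divK {2}<-.
  by move=> ->.
move=> d; apply/mapP/idP => [[e + ->]|dn].
  by rewrite -!dvdn_divisors // => en; apply: dvdn_div.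
by exists (n %/ d); rewrite ?divK // -dvdn_divisors // dvdn_div // dvdn_divisors.
Qed.

Lemma mobius_inversion (F f : nat -> int) n :
    0 < n ->
    (forall k, 0 < k -> k %| n -> F k = (\sum_(d <- divisors k) f d)%R) ->
  (\sum_(d <- divisors n) mobius (n %/ d) * F d = f n)%R.
Proof.
move=> n_gt0 FE.
transitivity (\sum_(c <- divisors n) mobius c * F (n %/ c)%N)%R.
  rewrite -(sum_divisors_codiv (fun c => mobius c * F (n %/ c)%N)%R n_gt0).
  apply: eq_big_seq => d; rewrite -dvdn_divisors // => dn.
  by rewrite divnA // mulKn.
have divs_gt0 c : c %| n -> 0 < n %/ c.
  by move=> cn; rewrite (divn_gt0 _ (dvdn_gt0 n_gt0 cn)); apply: dvdn_leq cn.
transitivity (\sum_(c < n.+1 | (c %| n)%N)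
                \sum_(e < n.+1 | (e %| n %/ c)%N) mobius c * f e)%R.
  rewrite (@sum_divisors n) ?n_gt0 //=; apply: eq_bigr => c cn.
  rewrite FE ?divs_gt0 ?dvdn_div // (@sum_divisors n) ?divs_gt0 ?leq_div //.
  by rewrite mulr_sumr.
rewrite (exchange_big_dep (fun e : 'I_n.+1 => e %| n)) /=; last first.
  by move=> c e cn /dvdn_trans; apply; apply: dvdn_div.
transitivity (\sum_(e < n.+1 | (e %| n)%N) (n %/ e == 1)%N%:R * f e)%R.
  apply: eq_bigr => e en.
  rewrite -sum_mobius ?divs_gt0 // (@sum_divisors n) ?divs_gt0 ?leq_div //.
  rewrite mulr_suml; apply: eq_bigl => c.
  have symE (x y : nat) : y %| n -> x %| n %/ y -> (y %| n %/ x) && (x %| n).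
    move=> yn xny; have xn : x %| n := dvdn_trans xny (dvdn_div yn).
    by rewrite xn andbT dvdn_divRL // mulnC -dvdn_divRL.
  apply/andP/idP => [[cn ecn]|cen]; first by have /andP[] := symE _ _ cn ecn.
  by have /andP[] := symE _ _ en cen.
rewrite (bigD1 ord_max) //= divnn n_gt0 eqxx mul1r big1 ?addr0 // => e.
case/andP=> en ne; rewrite [n %/ e == 1](_ : _ = false) ?mul0r //.
apply: contraNF ne => /eqP E; apply/eqP/val_inj => /=.
by have := divnK en; rewrite E mul1n.
Qed.

(** * Repetition and rotation of siteswaps *)

Definition psiteswap (n b kappa : nat) (x : nat -> seq nat) : Prop :=
  [/\ forall t, is_multiset (x t), forall t, size (x t) <= kappa,
      \sum_(t < n) sumn (x t) = b * n &
      forall B, (forall u, heights_in B (x u)) ->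
      forall t, size (x t) = air B n x t 0].

Lemma ss_validP n b kappa M :
    0 < n ->
  ss_valid n b kappa M <-> size M = n /\ psiteswap n b kappa (per [::] M).
Proof.
move=> n_gt0; split.
  move=> vM; have [[szM msM lM] bM kM] := vM; split=> //.
  have sz_gt0 : 0 < size M by rewrite szM.
  split.
  - exact: (elimT (all_perP [::] _ sz_gt0) msM).
  - exact: (elimT (all_perP [::] (fun m => size m <= kappa) sz_gt0) kM).
  - by rewrite -bM; apply: eq_bigr => t _; rewrite per_small ?szM.
  - move=> B hB t.
    rewrite (period_modn (f := fun t => air B n (per [::] M) t 0) (n := n)); last first.
      by move=> u; apply: air_period => v; rewrite -szM perD.
    rewrite -landings_air ?ltn_pmod //; last exact: (introT (all_perP [::] _ sz_gt0) hB).
    by rewrite -lM ?ltn_pmod // /per szM.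
case=> szM [ms kM bM lM].
have sz_gt0 : 0 < size M by rewrite szM.
have hM u : heights_in (b * n) (per [::] M u).
  apply/allP => h hm.
  have /andP[_ /allP/(_ _ hm) ->] := ms u.
  apply: (leq_trans (leq_sumn hm)); rewrite -bM.
  have lt_u : u %% n < n by rewrite ltn_pmod.
  rewrite (bigD1 (Ordinal lt_u)) //= (@per_mod _ _ _ (u %% n) u) ?leq_addr //.
  by rewrite szM modn_mod.
split; first split=> //.
- exact: (introT (all_perP [::] _ sz_gt0) ms).
- move=> t lt_t; rewrite -per_small ?szM // (lM _ hM).
  by rewrite -landings_air //; exact: (introT (all_perP [::] _ sz_gt0) hM).
- by rewrite /has_balls -bM; apply: eq_bigr => t _; rewrite per_small ?szM.
- exact: (introT (all_perP [::] (fun m => size m <= kappa) sz_gt0) kM).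
Qed.

Lemma psiteswap_ext n b kappa x y :
  x =1 y -> psiteswap n b kappa x -> psiteswap n b kappa y.
Proof.
move=> xy [ms kx bx lx]; split=> [t|t||B hB t]; rewrite -?xy //.
  by rewrite -bx; apply: eq_bigr => t _; rewrite xy.
rewrite (lx B); last by move=> u; rewrite xy.
by apply: eq_bigr => j _; rewrite xy.
Qed.

Lemma period_mul (T : Type) (x : nat -> T) n :
  (forall t, x (t + n) = x t) -> forall k t, x (t + k * n) = x t.
Proof.
by move=> xD; elim=> [|k IH] t; rewrite ?addn0 // mulSn addnA IH xD.
Qed.

Lemma psiteswap_shift n b kappa x k :
    0 < n -> (forall t, x (t + n) = x t) ->
  psiteswap n b kappa x -> psiteswap n b kappa (fun t => x (t + k)).
Proof.
move=> n_gt0 xD [ms kx bx lx]; split=> // [|B hB t].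
  rewrite -bx; elim: k => [|k <-]; first by apply: eq_bigr => t _; rewrite addn0.
  rewrite -[RHS](@sum_period n (fun t => sumn (x (t + k)))); last first.
    by move=> t; rewrite addnAC xD.
  by apply: eq_bigr => t _; rewrite addnS.
rewrite (lx B) => [|u]; first by apply: eq_bigr => j _; rewrite addnAC.
have := hB (u + k * n.-1).
have -> : u + k * n.-1 + k = u + k * n by nia.
by rewrite period_mul.
Qed.

Lemma sum_period_mul (f : nat -> nat) d c :
  (forall t, f (t + d) = f t) -> \sum_(t < c * d) f t = c * \sum_(t < d) f t.
Proof.
move=> fD; elim: c => [|c IH]; first by rewrite !mul0n big_ord0.
rewrite !mulSn big_split_ord /= -IH; congr (_ + _).
by apply: eq_bigr => t _; rewrite addnC fD.
Qed.

Lemma psiteswap_mul d c b kappa x :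
    0 < d -> 0 < c -> (forall t, x (t + d) = x t) ->
  psiteswap (c * d) b kappa x <-> psiteswap d b kappa x.
Proof.
move=> d_gt0 c_gt0 xD.
have airE B t : air B (c * d) x t 0 = air B d x t 0.
  apply: eq_bigr => j _; rewrite -[in RHS](period_mul xD (j.+1 * c.-1)).
  congr (count _ (x _)); rewrite -addnA; congr (_ + _).
  by rewrite -mulnA -mulnDr; congr (_ * _); nia.
have sumE := @sum_period_mul (fun t => sumn (x t)) d c
  (fun t => congr1 sumn (xD t)).
split=> -[ms kx bx lx]; split=> // [|B hB t].
- by apply/eqP; rewrite -(eqn_pmul2l c_gt0) -sumE bx mulnCA.
- by rewrite (lx B hB) airE.
- by rewrite sumE bx mulnCA.
- by rewrite (lx B hB) airE.
Qed.

Lemma per_rot (T : Type) (x0 : T) s k t :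
  0 < size s -> k <= size s -> per x0 (rot k s) t = per x0 s (t + k).
Proof.
move=> s_gt0 le_k; rewrite /per size_rot -(modnDml t).
have: t %% size s < size s by rewrite ltn_pmod.
move: (t %% size s) => u lt_u; rewrite /rot nth_cat size_drop nth_drop.
case: ltnP => [lt_uk|ge_uk]; first by rewrite addnC modn_small //; lia.
have -> : u + k = u - (size s - k) + size s by lia.
by rewrite modnDr modn_small ?nth_take //; lia.
Qed.

Lemma rot_period (T : Type) (x0 : T) s d :
    0 < size s -> d <= size s ->
  rot d s = s <-> forall t, per x0 s (t + d) = per x0 s t.
Proof.
move=> s_gt0 le_d; split=> [E t|E].
  by rewrite -per_rot // E.
apply: (@eq_from_nth _ x0); rewrite size_rot // => i lt_i.
by rewrite -per_small ?size_rot // per_rot // E per_small.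
Qed.

Lemma ss_valid_rot n b kappa k M :
  0 < n -> ss_valid n b kappa M -> ss_valid n b kappa (rot k M).
Proof.
move=> n_gt0 vM; have [szM pM] := (ss_validP b kappa M n_gt0).1 vM.
have [le_k|lt_k] := leqP k (size M); last by rewrite rot_oversize // ltnW.
apply/ss_validP => //; rewrite size_rot; split=> //.
apply: (psiteswap_ext (x := fun t => per [::] M (t + k))).
  by move=> t; rewrite per_rot // szM.
by apply: psiteswap_shift => // t; rewrite -szM perD.
Qed.

Definition primitive (M : seq (seq nat)) : bool :=
  all (fun d => rot d M != M) (iota 1 (size M).-1).

Lemma primitiveP n M : size M = n -> min_period n M <-> primitive M.
Proof.
move=> szM; split=> [mp|/allP pr d d_lt E].
  by apply/allP => d; rewrite mem_iota szM => d_lt; apply/eqP/mp; lia.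
have /pr : d \in iota 1 (size M).-1 by rewrite mem_iota szM; lia.
by rewrite E eqxx.
Qed.

Lemma primitive_period n M d :
    size M = n -> primitive M -> 0 < d < n ->
  ~ (forall t, per [::] M (t + d) = per [::] M t).
Proof.
move=> szM pM d_lt E.
apply: (proj2 (primitiveP szM) pM _ d_lt).
by apply/(@rot_period _ [::]) => //; lia.
Qed.

Lemma period_modn_period (T : Type) (x : nat -> T) d k :
    (forall t, x (t + d) = x t) -> (forall t, x (t + k) = x t) ->
  forall t, x (t + k %% d) = x t.
Proof.
move=> xd xk t; rewrite -[RHS]xk [in RHS](divn_eq k d) addnCA [in RHS]addnC.
by rewrite (period_mul xd).
Qed.

Lemma ss_count_by_period b kappa (F f : nat -> int) n :
    0 < n ->
    has_card (ss_valid n b kappa) (F n) ->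
    (forall d, d \in divisors n ->
       has_card (fun M => ss_valid d b kappa M /\ primitive M) (f d)) ->
  F n = (\sum_(d <- divisors n) f d)%R.
Proof.
move=> n_gt0 cF cf; apply: has_card_inj cF _.
have := has_card_sum (divisors_uniq n) cf.
move/(has_card_image (f := fun p => mkseq (per [::] p.2) n)); apply.
  move=> [d M] [e N] /=; rewrite -!dvdn_divisors //.
  move=> [dn [vM pM]] [en [vN pN]] E.
  have d_gt0 := dvdn_gt0 n_gt0 dn; have e_gt0 := dvdn_gt0 n_gt0 en.
  have [szM _] := (ss_validP b kappa M d_gt0).1 vM.
  have [szN _] := (ss_validP b kappa N e_gt0).1 vN.
  have MD t : per [::] M (t + d) = per [::] M t by rewrite -szM perD.
  have ND t : per [::] N (t + e) = per [::] N t by rewrite -szN perD.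
  have perE t : per [::] M t = per [::] N t.
    have perK (x : nat -> seq nat) m :
        (forall t, x (t + m) = x t) -> m %| n -> x t = nth [::] (mkseq x n) (t %% n).
      move=> xm /dvdnP[c nE]; rewrite nth_mkseq ?ltn_pmod // -period_modn //.
      by rewrite nE; apply: period_mul.
    by rewrite (perK _ _ MD) // (perK _ _ ND) // E.
  have de : d = e.
    have [lt_de|lt_ed|//] := ltngtP d e.
      case: (@primitive_period e N d szN pN); first by rewrite d_gt0.
      by move=> t; rewrite -!perE.
    case: (@primitive_period d M e szM pM); first by rewrite e_gt0.
    by move=> t; rewrite !perE.
  rewrite de; congr (_, _).
  rewrite -(mkseq_per [::] M) -(mkseq_per [::] N) szM szN de.
  exact: eq_mkseq.
move=> M; split; last first.
  case=> -[d N] /= []; rewrite -dvdn_divisors // => dn [vN _] ->.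
  have d_gt0 := dvdn_gt0 n_gt0 dn.
  have [szN pN] := (ss_validP b kappa N d_gt0).1 vN.
  have ND t : per [::] N (t + d) = per [::] N t by rewrite -szN perD.
  have nE := esym (divnK dn).
  have c_gt0 : 0 < n %/ d by rewrite divn_gt0 // dvdn_leq.
  apply/ss_validP => //; rewrite size_mkseq; split=> //.
  apply: (psiteswap_ext (x := per [::] N)).
    by move=> t; rewrite per_mkseq // => u; rewrite nE period_mul.
  by rewrite nE; apply/psiteswap_mul.
move=> vM; have [szM pM] := (ss_validP b kappa M n_gt0).1 vM.
have M_gt0 : 0 < size M by rewrite szM.
have MD t : per [::] M (t + n) = per [::] M t by rewrite -szM perD.
have exP : exists d, (0 < d <= n) && (rot d M == M).
  by exists n; rewrite n_gt0 leqnn -{1}szM rot_size eqxx.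
case: (ex_minnP exP) => d /andP[/andP[d_gt0 le_dn] /eqP rotd] dmin.
have xd : forall t, per [::] M (t + d) = per [::] M t.
  by apply/rot_period; rewrite ?szM.
have dn : d %| n.
  rewrite /dvdn; apply/eqP; have [//|r_gt0] := posnP (n %% d).
  have lt_r : n %% d < d by rewrite ltn_pmod.
  have /dmin : (0 < n %% d <= n) && (rot (n %% d) M == M).
    rewrite r_gt0 (leq_trans (ltnW lt_r) le_dn) /=.
    apply/eqP/(@rot_period _ [::]); rewrite ?szM ?(leq_trans (ltnW lt_r) le_dn) //.
    exact: period_modn_period.
  by rewrite leqNgt lt_r.
have nE := esym (divnK dn).
have c_gt0 : 0 < n %/ d by rewrite divn_gt0 // dvdn_leq.
set N := mkseq (per [::] M) d.
have perN : per [::] N =1 per [::] M by move=> t; apply: per_mkseq.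
exists (d, N); last first.
  rewrite /= -[LHS](mkseq_per [::]) szM; apply: eq_mkseq => t.
  by rewrite perN.
rewrite /= -dvdn_divisors //; split=> //; split.
  apply/ss_validP => //; rewrite size_mkseq; split=> //.
  apply: (psiteswap_ext (x := per [::] M)); first by move=> t; rewrite perN.
  by apply/(psiteswap_mul b kappa d_gt0 c_gt0 xd); rewrite -nE.
apply/(@primitiveP d); first by rewrite size_mkseq.
move=> e e_lt rote.
have xe : forall t, per [::] M (t + e) = per [::] M t.
  move=> t; rewrite -!perN; apply/rot_period: t => //; rewrite size_mkseq //; lia.
have /dmin : (0 < e <= n) && (rot e M == M).
  rewrite (_ : 0 < e <= n); last by lia.
  by apply/eqP/(@rot_period _ [::]); rewrite ?szM //; lia.
by lia.
Qed.

(** * Rotation classes *)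

Lemma rot_equiv_sym M1 M2 : rot_equiv M1 M2 -> rot_equiv M2 M1.
Proof. by case=> k <-; exists (size (rot k M1) - k); apply: rotK. Qed.

Lemma rot_equiv_trans M2 M1 M3 : rot_equiv M1 M2 -> rot_equiv M2 M3 -> rot_equiv M1 M3.
Proof.
case=> k <- [l <-].
have [le_k|lt_k] := leqP k (size M1); last first.
  by exists l; rewrite (rot_oversize (ltnW lt_k)).
have [le_l|lt_l] := leqP l (size M1); last first.
  by exists k; rewrite [RHS]rot_oversize // size_rot ltnW.
by rewrite rot_add_mod //; eexists.
Qed.

Lemma mem_rotations n M N :
  0 < n -> size M = n -> rot_equiv M N <-> N \in mkseq (fun k => rot k M) n.
Proof.
move=> n_gt0 szM; split=> [[k <-]|/mapP[k _ ->]]; last by exists k.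
apply/mapP; have [lt_k|le_k] := ltnP k n; first by exists k; rewrite ?mem_iota.
by exists 0; rewrite ?mem_iota // rot0 rot_oversize // szM.
Qed.

Lemma uniq_rotations n M :
  size M = n -> min_period n M -> uniq (mkseq (fun k => rot k M) n).
Proof.
move=> szM pM.
have rot_neq i j : i < j < n -> rot i M <> rot j M.
  move=> ij; have -> : j = i + (j - i) by lia.
  rewrite rotD; last by lia.
  by move=> /rot_inj /esym; apply: pM; lia.
apply/mkseq_uniqP => i j; rewrite !inE => lt_i lt_j E.
by have [ij|ij|//] := ltngtP i j; [case: (rot_neq i j) | case: (rot_neq j i)];
  rewrite ?ij.
Qed.

Lemma rotation_representatives n (L : seq (seq (seq nat))) :
    0 < n -> uniq L ->
    (forall M, M \in L -> size M = n /\ min_period n M) ->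
    (forall M k, M \in L -> rot k M \in L) ->
  exists R : seq (seq (seq nat)),
    [/\ uniq R, {subset R <= L},
        forall M, M \in L -> exists2 M', M' \in R & rot_equiv M M',
        forall M1 M2, M1 \in R -> M2 \in R -> rot_equiv M1 M2 -> M1 = M2 &
        size L = n * size R].
Proof.
move=> n_gt0; have [N] := ubnP (size L); elim: N L => // N IH [|M L'] lt_N uL pL rL.
  by exists [::]; split=> //; rewrite muln0.
set L := M :: L' in lt_N uL pL rL *.
have ML : M \in L := mem_head M L'.
have [szM pM] := pL M ML.
pose O := mkseq (fun k => rot k M) n.
have OE N' : rot_equiv M N' <-> N' \in O := mem_rotations N' n_gt0 szM.
have subO : {subset O <= L} by move=> _ /mapP[k _ ->]; apply: rL.
pose K := [seq N' <- L | N' \notin O].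
have szL : size L = n + size K.
  rewrite -(count_predC (mem O) L) -!size_filter; congr (_ + _).
  rewrite -[RHS](size_mkseq (fun k => rot k M)); apply: perm_size.
  apply: uniq_perm; rewrite ?filter_uniq //; first exact: uniq_rotations.
  move=> N'; rewrite mem_filter /= -/O.
  by have [/subO ->|] := boolP (N' \in O).
have [||||R [uR subR exR injR szR]] := IH K.
- by move: lt_N; rewrite szL ltnS; apply: leq_trans; rewrite -add1n leq_add2r.
- exact: filter_uniq.
- by move=> N'; rewrite mem_filter => /andP[_ /pL].
- move=> N' k; rewrite !mem_filter => /andP[N'O N'L]; rewrite rL // andbT.
  apply: contra N'O => /OE MN; apply/OE; apply: rot_equiv_trans MN _.
  by apply: rot_equiv_sym; exists k.
have notO N' : N' \in R -> ~ rot_equiv M N'.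
  by move=> /subR; rewrite mem_filter => /andP[/negP N'O _] /OE.
exists (M :: R); split.
- rewrite /= uR andbT; apply/negP => /notO; apply; exists 0; exact: rot0.
- by move=> N'; rewrite inE => /orP[/eqP ->|/subR]; rewrite // mem_filter => /andP[].
- move=> N' N'L; have [N'O|N'O] := boolP (N' \in O).
    by exists M; [apply: mem_head | apply/rot_equiv_sym/OE].
  have /exR[M' M'R eqM'] : N' \in K by rewrite mem_filter N'O.
  by exists M' => //; rewrite inE M'R orbT.
- move=> M1 M2; rewrite !inE => /orP[/eqP ->|M1R] /orP[/eqP ->|M2R] // eqM.
  + by case: (notO M2).
  + by case: (notO M1) => //; apply: rot_equiv_sym.
  + exact: injR.
- by rewrite szL szR /= mulnS.
Qed.

Definition ss_count (b kappa n : nat) : int :=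
  (trA b kappa n - \sum_(b - kappa <= i < b) trA i kappa n)%R.

Lemma has_card_primitive_ss b kappa n :
    0 < n ->
  has_card (fun M => ss_valid n b kappa M /\ primitive M)
    (\sum_(d <- divisors n) mobius (n %/ d) * ss_count b kappa d)%R.
Proof.
move=> n_gt0.
have /fin_all_exists[f cf] (d : 'I_n) :
    exists z, has_card (fun M => ss_valid d.+1 b kappa M /\ primitive M) z.
  exact: has_card_filter (has_card_ss_valid b kappa (ltn0Sn d)).
have {}cf d : 0 < d <= n ->
    has_card (fun M => ss_valid d b kappa M /\ primitive M)
             (f (insubd (Ordinal n_gt0) d.-1)).
  move=> d_in; have := cf (insubd (Ordinal n_gt0) d.-1).
  by rewrite val_insubd ifT ?prednK //; lia.
rewrite (mobius_inversion (f := fun d => f (insubd (Ordinal n_gt0) d.-1))) //.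
  by apply: cf; rewrite n_gt0 leqnn.
move=> k k_gt0 kn; apply: ss_count_by_period => //; first exact: has_card_ss_valid.
move=> d; rewrite -dvdn_divisors // => dk; apply: cf.
by rewrite (dvdn_gt0 k_gt0 dk) (dvdn_leq n_gt0 (dvdn_trans dk kn)).
Qed.

Unset Implicit Arguments.
Local Open Scope ring_scope.

Theorem theorem12 (kappa b n : nat) (hk : (1 <= kappa)%N) (hn : (1 <= n)%N) :
  (exists L : seq (seq (seq nat)),
      [/\ uniq L,
          forall M, M \in L <-> ss_valid n b kappa M &
          (size L)%:Z = trA b kappa n - \sum_(b - kappa <= i < b) trA i kappa n])
  /\
  (exists R : seq (seq (seq nat)),
      [/\ uniq R,
          forall M, M \in R -> ss_valid n b kappa M /\ min_period n M,
          forall M, ss_valid n b kappa M -> min_period n M ->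
                    exists2 M', M' \in R & rot_equiv M M',
          forall M1 M2, M1 \in R -> M2 \in R -> rot_equiv M1 M2 -> M1 = M2 &
          (size R)%:Q = n%:Q^-1 *
            \sum_(d <- divisors n)
               ((mobius (n %/ d))%:~R *
                (trA b kappa d - \sum_(b - kappa <= i < b) trA i kappa d)%:~R)]).
Proof.
split; first exact: has_card_ss_valid.
have [L [uL mL szL]] := has_card_primitive_ss b kappa hn.
have sizeL M : ss_valid n b kappa M -> size M = n by case=> -[].
have memL M : M \in L <-> ss_valid n b kappa M /\ min_period n M.
  by rewrite mL; split=> -[vM] /(primitiveP (sizeL _ vM)).
have [||||R [uR subR exR injR szR]] := @rotation_representatives n L.
- exact: hn.
- exact: uL.
- by move=> M /memL[vM pM]; split=> //; apply: sizeL.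
- move=> M k /memL[vM pM]; apply/memL; split; first exact: ss_valid_rot.
  move=> d d_lt; rewrite rot_rot => /rot_inj; exact: pM.
exists R; split=> //.
- by move=> M /subR/memL.
- by move=> M vM pM; apply: exR; apply/memL.
have n_neq0 : n%:Q != 0 by rewrite intr_eq0 -lt0n.
apply: (mulfI n_neq0); rewrite mulrA divff // mul1r -intrM -PoszM -szR szL.
by rewrite rmorph_sum; apply: eq_bigr => d _; rewrite rmorphM.
Qed.
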